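(* Let $K$ be a field of characteristic zero. The question (JD) has an affirmative answer if and only if both the Jacobian Conjecture (JC) and the Dixmier Problem (DP) have affirmative answers. In more detail, $JD_n\Leftrightarrow JC_n+DP_n$, i.e. $JD_n$ has an affirmative answer if and only if both $JC_n$ and $DP_n$ have.
   Context: $K^*=K\setminus\{0\}$. $A_n$ is the $n$-th Weyl algebra over $K$: generated by $q_1,\dots,q_n,p_1,\dots,p_n$ subject to $[p_i,q_j]=\delta_{ij}$, $[p_i,p_j]=[q_i,q_j]=0$, where $[a,b]=ab-ba$. $P_m=K[x_1,\dots,x_m]$ is a polynomial algebra; it is the centre of $A_n\otimes P_m$, where $\otimes=\otimes_K$. (JD): is a $K$-algebra endomorphism $\sigma:A_n\otimes P_m\to A_n\otimes P_m$ an algebra automorphism provided $\det\left(\frac{\partial\sigma(x_i)}{\partial x_j}\right)_{1\le i,j\le m}\in K^*$? (for all $n,m$; the elements $\sigma(x_i)$ lie in $P_m$, and the determinant is $1$ when $m=0$.) (JC): is every $K$-algebra endomorphism $\sigma$ of $P_m$ with $\det\left(\frac{\partial\sigma(x_i)}{\partial x_j}\right)\in K^*$ an automorphism? (for all $m$.) (DP): is every $K$-algebra endomorphism of the Weyl algebra $A_n$ an automorphism? (for all $n$.) The index $n$ denotes the question for that fixed $n$: $JC_n$ is (JC) for $P_n$, $DP_n$ is (DP) for $A_n$, and $JD_n$ is (JD) for $A_n\otimes P_n$. *)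

(* Defs.v *)
From HB Require Import structures.
From mathcomp Require Import all_boot all_order all_algebra.
From mathcomp.classical Require Import boolp.
From mathcomp.multinomials Require Import mpoly.

Set Implicit Arguments.
Unset Strict Implicit.
Unset Printing Implicit Defensive.

Import GRing.Theory.
Local Open Scope ring_scope.
Local Open Scope quotient_scope.

(******************************************************************************)
(* presalg rel == the associative unital K-algebra generated by X subject to  *)
(*                the relations t = u for rel t u, where t and u are          *)
(*                noncommutative polynomial expressions (pterm K X) in the    *)
(*                generators; it is the quotient of the expressions by the    *)
(*                least congruence containing the K-algebra axioms and rel.   *)
(*  pgen rel x == the class of the generator x in presalg rel                 *)
(*    weyl K n == the n-th Weyl algebra, with generators weylQ i, weylP i     *)
(* tensalg A B == the tensor product over K of the K-algebras A and B         *)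
(*    tens a b == the pure tensor of a : A and b : B                          *)
(* weyl_poly K n m == the tensor product of the n-th Weyl algebra and         *)
(*                {mpoly K[m]}                                                *)
(******************************************************************************)

Section PresentedAlgebra.
Variables (K : fieldType) (X : Type).

Inductive pterm :=
| PGen of X
| PCst of K
| PAdd of pterm & pterm
| PMul of pterm & pterm.

HB.instance Definition _ := gen_eqMixin pterm.
HB.instance Definition _ := gen_choiceMixin pterm.

Definition POpp t := PMul (PCst (-1)) t.
Definition PComm t u := PAdd (PMul t u) (POpp (PMul u t)).

Variable rel : pterm -> pterm -> Prop.

Inductive pcong : pterm -> pterm -> Prop :=
| PC_rel t u : rel t u -> pcong t u
| PC_refl t : pcong t t
| PC_sym t u : pcong t u -> pcong u t
| PC_trans t u v : pcong t u -> pcong u v -> pcong t v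
| PC_add t t' u u' : pcong t t' -> pcong u u' -> pcong (PAdd t u) (PAdd t' u')
| PC_mul t t' u u' : pcong t t' -> pcong u u' -> pcong (PMul t u) (PMul t' u')
| PC_addA t u v : pcong (PAdd t (PAdd u v)) (PAdd (PAdd t u) v)
| PC_addC t u : pcong (PAdd t u) (PAdd u t)
| PC_add0 t : pcong (PAdd (PCst 0) t) t
| PC_addN t : pcong (PAdd (POpp t) t) (PCst 0)
| PC_mulA t u v : pcong (PMul t (PMul u v)) (PMul (PMul t u) v)
| PC_mul1l t : pcong (PMul (PCst 1) t) t
| PC_mul1r t : pcong (PMul t (PCst 1)) t
| PC_mulDl t u v : pcong (PMul (PAdd t u) v) (PAdd (PMul t v) (PMul u v))
| PC_mulDr t u v : pcong (PMul t (PAdd u v)) (PAdd (PMul t u) (PMul t v))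
| PC_cstD c d : pcong (PCst (c + d)) (PAdd (PCst c) (PCst d))
| PC_cstM c d : pcong (PCst (c * d)) (PMul (PCst c) (PCst d))
| PC_cstC c t : pcong (PMul (PCst c) t) (PMul t (PCst c)).

Definition pcongb t u := `[< pcong t u >].

Lemma pcongb_equiv : equiv_class_of pcongb.
Proof.
split=> [t|t u|u t v].
- exact/asboolP/PC_refl.
- by apply/asboolP/asboolP; apply: PC_sym.
- by move=> /asboolP tu /asboolP uv; apply/asboolP/(PC_trans tu uv).
Qed.

Canonical pcong_equivRel := EquivRelPack pcongb_equiv.

Definition presalg := {eq_quot pcong_equivRel}.

HB.instance Definition _ := Choice.on presalg.
HB.instance Definition _ := EqQuotient.on presalg.

Lemma presalg_eqP t u : \pi_presalg t = \pi_presalg u <-> pcong t u.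
Proof. by split=> [/eqmodP/asboolP//|tu]; apply/eqmodP/asboolP. Qed.

Definition pgen x : presalg := \pi_presalg (PGen x).
Definition pre_zero : presalg := \pi_presalg (PCst 0).
Definition pre_one : presalg := \pi_presalg (PCst 1).
Definition pre_add (a b : presalg) : presalg := \pi_presalg (PAdd (repr a) (repr b)).
Definition pre_opp (a : presalg) : presalg := \pi_presalg (POpp (repr a)).
Definition pre_mul (a b : presalg) : presalg := \pi_presalg (PMul (repr a) (repr b)).
Definition pre_scale c (a : presalg) : presalg := \pi_presalg (PMul (PCst c) (repr a)).

Lemma repr_cong t : pcong (repr (\pi_presalg t)) t.
Proof. by apply/presalg_eqP; rewrite reprK. Qed.

Lemma pre_addE t u : pre_add (\pi_presalg t) (\pi_presalg u) = \pi_presalg (PAdd t u).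
Proof. by apply/presalg_eqP/PC_add; apply: repr_cong. Qed.

Lemma pre_mulE t u : pre_mul (\pi_presalg t) (\pi_presalg u) = \pi_presalg (PMul t u).
Proof. by apply/presalg_eqP/PC_mul; apply: repr_cong. Qed.

Lemma pre_scaleE c t : pre_scale c (\pi_presalg t) = \pi_presalg (PMul (PCst c) t).
Proof. by apply/presalg_eqP/PC_mul; [apply: PC_refl|apply: repr_cong]. Qed.

Lemma pre_oppE t : pre_opp (\pi_presalg t) = \pi_presalg (POpp t).
Proof. by apply/presalg_eqP/PC_mul; [apply: PC_refl|apply: repr_cong]. Qed.

Lemma presalg_ind (P : presalg -> Prop) : (forall t, P (\pi_presalg t)) -> forall a, P a.
Proof. by move=> Pt a; rewrite -[a]reprK. Qed.

Lemma pre_addrA : associative pre_add.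
Proof.
elim/presalg_ind=> t; elim/presalg_ind=> u; elim/presalg_ind=> v.
by rewrite !pre_addE; apply/presalg_eqP/PC_addA.
Qed.

Lemma pre_addrC : commutative pre_add.
Proof. by elim/presalg_ind=> t; elim/presalg_ind=> u; rewrite !pre_addE; apply/presalg_eqP/PC_addC. Qed.

Lemma pre_add0r : left_id pre_zero pre_add.
Proof. by elim/presalg_ind=> t; rewrite !pre_addE; apply/presalg_eqP/PC_add0. Qed.

Lemma pre_addNr : left_inverse pre_zero pre_opp pre_add.
Proof. by elim/presalg_ind=> t; rewrite pre_oppE pre_addE; apply/presalg_eqP/PC_addN. Qed.

HB.instance Definition _ :=
  GRing.isZmodule.Build presalg pre_addrA pre_addrC pre_add0r pre_addNr.

Lemma pre_mulrA : associative pre_mul.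
Proof.
elim/presalg_ind=> t; elim/presalg_ind=> u; elim/presalg_ind=> v.
by rewrite !pre_mulE; apply/presalg_eqP/PC_mulA.
Qed.

Lemma pre_mul1r : left_id pre_one pre_mul.
Proof. by elim/presalg_ind=> t; rewrite !pre_mulE; apply/presalg_eqP/PC_mul1l. Qed.

Lemma pre_mulr1 : right_id pre_one pre_mul.
Proof. by elim/presalg_ind=> t; rewrite !pre_mulE; apply/presalg_eqP/PC_mul1r. Qed.

Lemma pre_mulrDl : left_distributive pre_mul +%R.
Proof.
elim/presalg_ind=> t; elim/presalg_ind=> u; elim/presalg_ind=> v.
rewrite -[_ + _]/(pre_add _ _) -[RHS]/(pre_add _ _).
by rewrite !(pre_addE, pre_mulE); apply/presalg_eqP/PC_mulDl.
Qed.

Lemma pre_mulrDr : right_distributive pre_mul +%R.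
Proof.
elim/presalg_ind=> t; elim/presalg_ind=> u; elim/presalg_ind=> v.
rewrite -[_ + _]/(pre_add _ _) -[RHS]/(pre_add _ _).
by rewrite !(pre_addE, pre_mulE); apply/presalg_eqP/PC_mulDr.
Qed.

HB.instance Definition _ :=
  GRing.Zmodule_isPzRing.Build presalg pre_mulrA pre_mul1r pre_mulr1 pre_mulrDl pre_mulrDr.

Lemma pre_scalerA c d a : pre_scale c (pre_scale d a) = pre_scale (c * d) a.
Proof.
elim/presalg_ind: a => t; rewrite !pre_scaleE; apply/presalg_eqP.
by apply: PC_trans (PC_mulA _ _ _) _; apply/PC_mul/PC_refl/PC_sym/PC_cstM.
Qed.

Lemma pre_scale1r : left_id 1 pre_scale.
Proof. by elim/presalg_ind=> t; rewrite pre_scaleE; apply/presalg_eqP/PC_mul1l. Qed.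

Lemma pre_scalerDr : right_distributive pre_scale +%R.
Proof.
move=> c; elim/presalg_ind=> t; elim/presalg_ind=> u.
rewrite -[_ + _]/(pre_add _ _) -[RHS]/(pre_add _ _).
by rewrite !(pre_addE, pre_scaleE); apply/presalg_eqP/PC_mulDr.
Qed.

Lemma pre_scalerDl a : {morph pre_scale^~ a : c d / c + d}.
Proof.
elim/presalg_ind: a => t c d; rewrite -[RHS]/(pre_add _ _) !(pre_addE, pre_scaleE); apply/presalg_eqP.
by apply: PC_trans (PC_mulDl _ _ _); apply/PC_mul/PC_refl/PC_cstD.
Qed.

HB.instance Definition _ :=
  GRing.Zmodule_isLmodule.Build K presalg pre_scalerA pre_scale1r pre_scalerDr pre_scalerDl.

Lemma piD t u : \pi_presalg (PAdd t u) = \pi_presalg t + \pi_presalg u.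
Proof. by rewrite -pre_addE. Qed.

Lemma piM t u : \pi_presalg (PMul t u) = \pi_presalg t * \pi_presalg u.
Proof. by rewrite -pre_mulE. Qed.

Lemma piC c : \pi_presalg (PCst c) = c *: (1 : presalg).
Proof.
by rewrite -[RHS]/(pre_scale _ _) pre_scaleE; apply/presalg_eqP/PC_sym/PC_mul1r.
Qed.

Lemma piZ c t : \pi_presalg (PMul (PCst c) t) = c *: (\pi_presalg t : presalg).
Proof. by rewrite -[RHS]/(pre_scale _ _) pre_scaleE. Qed.

Lemma presalg_scalerAl c (a b : presalg) : c *: (a * b) = (c *: a) * b.
Proof.
elim/presalg_ind: a => t; elim/presalg_ind: b => u.
rewrite -[_ * _]/(pre_mul _ _) -[LHS]/(pre_scale _ _).
rewrite -[_ *: _]/(pre_scale _ _) -[RHS]/(pre_mul _ _).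
by rewrite !(pre_mulE, pre_scaleE); apply/presalg_eqP/PC_mulA.
Qed.

Lemma presalg_scalerAr c (a b : presalg) : c *: (a * b) = a * (c *: b).
Proof.
have sE (x : presalg) : c *: x = x * (c *: (1 : presalg)).
  elim/presalg_ind: x => t; rewrite -piC -piM -[LHS]/(pre_scale _ _) pre_scaleE.
  exact/presalg_eqP/PC_cstC.
by rewrite sE [c *: b]sE mulrA.
Qed.

Lemma piN t : \pi_presalg (POpp t) = - \pi_presalg t.
Proof. by rewrite piM piC scaleN1r mulN1r. Qed.

Lemma piComm t u : \pi_presalg (PComm t u) =
  \pi_presalg t * \pi_presalg u - \pi_presalg u * \pi_presalg t.
Proof. by rewrite piD piN !piM. Qed.

Section Action.
Variables (V : lmodType K) (g : X -> V -> V).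

Fixpoint pact t : V -> V :=
  match t with
  | PGen x => g x
  | PCst c => fun v => c *: v
  | PAdd t u => fun v => pact t v + pact u v
  | PMul t u => fun v => pact t (pact u v)
  end.

Hypothesis g_linear : forall x, linear (g x).
Hypothesis g_rel : forall t u, rel t u -> pact t =1 pact u.

Lemma pact_linear t : linear (pact t).
Proof.
elim: t => [x|c|t IHt u IHu|t IHt u IHu] d v w /=; first exact: g_linear.
- by rewrite scalerDr !scalerA mulrC.
- by rewrite IHt IHu scalerDr !addrA; congr (_ + _); rewrite addrAC.
- by rewrite IHu IHt.
Qed.

Lemma pactD t v w : pact t (v + w) = pact t v + pact t w.
Proof. by have := pact_linear t 1 v w; rewrite !scale1r. Qed.

Lemma pactZ t c v : pact t (c *: v) = c *: pact t v.
Proof.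
have := pact_linear t c v 0; rewrite addr0 => ->.
have := pact_linear t (-1) 0 0; rewrite scaleN1r oppr0 addr0 scaleN1r addNr => ->.
by rewrite addr0.
Qed.

Lemma pact_cong t u : pcong t u -> pact t =1 pact u.
Proof.
elim=> {t u} /=.
- exact: g_rel.
- by [].
- by move=> t u _ IH v; rewrite IH.
- by move=> t u w _ IH _ IH' v; rewrite IH IH'.
- by move=> t t' u u' _ IH _ IH' v; rewrite IH IH'.
- by move=> t t' u u' _ IH _ IH' v; rewrite IH IH'.
- by move=> t u w v; rewrite addrA.
- by move=> t u v; rewrite addrC.
- by move=> t v; rewrite scale0r add0r.
- by move=> t v; rewrite scaleN1r addNr scale0r.
- by [].
- by move=> t v; rewrite scale1r.
- by move=> t v; rewrite scale1r.
- by [].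
- by move=> t u w v; rewrite pactD.
- by move=> c d v; rewrite scalerDl.
- by move=> c d v; rewrite scalerA.
- by move=> c t v; rewrite pactZ.
Qed.

Definition presalg_act (a : presalg) : V -> V := pact (repr a).

Lemma presalg_actE t : presalg_act (\pi_presalg t) =1 pact t.
Proof. by apply: pact_cong; apply/presalg_eqP; rewrite reprK. Qed.

End Action.

(* Universal property: an assignment of the generators in a K-algebra B that  *)
(* satisfies the relations extends uniquely to a morphism of K-algebras.      *)
Section Lift.
Variables (B : algType K) (g : X -> B).

Fixpoint peval t : B :=
  match t with
  | PGen x => g x
  | PCst c => c%:A
  | PAdd t u => peval t + peval u
  | PMul t u => peval t * peval u
  end.

Hypothesis g_rel : forall t u, rel t u -> peval t = peval u.

Lemma peval_cong t u : pcong t u -> peval t = peval u.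
Proof.
elim=> {t u} /=.
- exact: g_rel.
- by [].
- by move=> t u _ ->.
- by move=> t u v _ -> _ ->.
- by move=> t t' u u' _ -> _ ->.
- by move=> t t' u u' _ -> _ ->.
- by move=> t u v; rewrite addrA.
- by move=> t u; rewrite addrC.
- by move=> t; rewrite scale0r add0r.
- by move=> t; rewrite scaleN1r mulN1r addNr scale0r.
- by move=> t u v; rewrite mulrA.
- by move=> t; rewrite scale1r mul1r.
- by move=> t; rewrite scale1r mulr1.
- by move=> t u v; rewrite mulrDl.
- by move=> t u v; rewrite mulrDr.
- by move=> c d; rewrite scalerDl.
- by move=> c d; rewrite -scalerAl mul1r scalerA.
- by move=> c t; rewrite -scalerAl -scalerAr mul1r mulr1.
Qed.

Lemma presalg_univ : exists! f : presalg -> B,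
  [/\ {morph f : a b / a + b}, {morph f : a b / a * b}, f 1 = 1,
      scalable f & forall x, f (pgen x) = g x].
Proof.
pose f (a : presalg) := peval (repr a).
have fE t : f (\pi_presalg t) = peval t by apply/peval_cong/repr_cong.
have oneE : (1 : presalg) = \pi_presalg (PCst 1) by [].
exists f; split=> [|h [hD hM h1 hZ hg]].
  split.
  - by elim/presalg_ind=> t; elim/presalg_ind=> u; rewrite -piD !fE.
  - by elim/presalg_ind=> t; elim/presalg_ind=> u; rewrite -piM !fE.
  - by rewrite oneE fE /= scale1r.
  - move=> c; elim/presalg_ind=> t.
    rewrite -[_ *: _]/(pre_scale _ _) pre_scaleE !fE /=.
    by rewrite -scalerAl mul1r.
  - by move=> x; rewrite fE.
apply/funext; elim/presalg_ind=> t; rewrite fE.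
elim: t => [x|c|t IHt u IHu|t IHt u IHu] /=.
- by rewrite hg.
- by rewrite piC hZ h1.
- by rewrite piD hD IHt IHu.
- by rewrite piM hM IHt IHu.
Qed.

End Lift.

End PresentedAlgebra.

Arguments PGen {K X}.
Arguments PCst {K X}.

Inductive weyl_gen (n : nat) := GQ of 'I_n | GP of 'I_n.

Inductive weyl_rel (K : fieldType) (n : nat) :
    pterm K (weyl_gen n) -> pterm K (weyl_gen n) -> Prop :=
| Weyl_pq i j :
    weyl_rel (PComm (PGen (GP i)) (PGen (GQ j))) (PCst (i == j)%:R)
| Weyl_pp i j : weyl_rel (PComm (PGen (GP i)) (PGen (GP j))) (PCst 0)
| Weyl_qq i j : weyl_rel (PComm (PGen (GQ i)) (PGen (GQ j))) (PCst 0).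

Definition weyl (K : fieldType) (n : nat) := presalg (@weyl_rel K n).

Section WeylAlgebra.
Variables (K : fieldType) (n : nat).
Local Notation P := {mpoly K[n]}.

HB.instance Definition _ := GRing.PzRing.on (weyl K n).
HB.instance Definition _ := GRing.Lmodule.on (weyl K n).

Definition weylQ i : weyl K n := pgen (@weyl_rel K n) (GQ i).
Definition weylP i : weyl K n := pgen (@weyl_rel K n) (GP i).

(* The Weyl algebra acts on polynomials by differential operators; the action *)
(* shows that 1 != 0.                                                         *)
Definition weyl_gact (x : weyl_gen n) (f : P) : P :=
  match x with GQ i => 'X_i * f | GP i => mderiv i f end.

Lemma weyl_gact_linear x : linear (weyl_gact x).
Proof.
case: x => i c f h /=; last by rewrite linearP.
by rewrite mulrDr scalerAr.
Qed.

Lemma weyl_gact_rel t u : weyl_rel t u -> pact weyl_gact t =1 pact weyl_gact u.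
Proof.
case=> i j f /=; rewrite scaleN1r ?scale0r.
- rewrite mderivM addrK mderivX mnm1E eq_sym.
  case: eqP => [->|_]; last by rewrite !scale0r mul0r.
  suff ->: (U_(j) - U_(j) = 0 :> 'X_{1..n})%MM.
    by rewrite scale1r mpolyX0 mul1r scale1r.
  by apply/mnmP=> k; rewrite mnmBE subnn mnm0E.
- by rewrite mderiv_comm subrr.
- by rewrite mulrCA subrr.
Qed.

Definition weyl_act : weyl K n -> P -> P := presalg_act weyl_gact.

Lemma weyl_actE t :
  weyl_act (\pi_(presalg (@weyl_rel K n)) t) =1 pact weyl_gact t.
Proof. exact: presalg_actE weyl_gact_linear weyl_gact_rel t. Qed.

Lemma weyl_oner_neq0 : (1 : weyl K n) != 0.
Proof.
apply/eqP => eq10; have: weyl_act 1 1 = weyl_act 0 1 by rewrite eq10.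
rewrite !weyl_actE /= scale1r scale0r; exact/eqP/oner_neq0.
Qed.

HB.instance Definition _ :=
  GRing.PzSemiRing_isNonZero.Build (weyl K n) weyl_oner_neq0.
HB.instance Definition _ :=
  GRing.Lmodule_isLalgebra.Build K (weyl K n) (@presalg_scalerAl _ _ _).
HB.instance Definition _ :=
  GRing.Lalgebra_isAlgebra.Build K (weyl K n) (@presalg_scalerAr _ _ _).

Lemma weyl_relations :
  [/\ forall i j, weylP i * weylQ j - weylQ j * weylP i = (i == j)%:R,
      forall i j, weylP i * weylP j - weylP j * weylP i = 0 &
      forall i j, weylQ i * weylQ j - weylQ j * weylQ i = 0].
Proof.
have H t u : weyl_rel t u ->
    \pi_(presalg (@weyl_rel K n)) t = \pi_(presalg (@weyl_rel K n)) u.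
  by move=> tu; apply/presalg_eqP/PC_rel.
split=> i j; rewrite -piComm.
- by rewrite (H _ _ (Weyl_pq K i j)) piC scaler_nat.
- by rewrite (H _ _ (Weyl_pp K i j)) piC scale0r.
- by rewrite (H _ _ (Weyl_qq K i j)) piC scale0r.
Qed.

End WeylAlgebra.

Section TensorAlgebra.
Variables (K : fieldType) (A B : algType K).

(* The first four relations give the tensor product of the underlying vector  *)
(* spaces; the last two give its multiplication and its unit.                 *)
Inductive tens_rel : pterm K (A * B) -> pterm K (A * B) -> Prop :=
| Tens_Dl (a a' : A) (b : B) :
    tens_rel (PGen (a + a', b)) (PAdd (PGen (a, b)) (PGen (a', b)))
| Tens_Dr (a : A) (b b' : B) :
    tens_rel (PGen (a, b + b')) (PAdd (PGen (a, b)) (PGen (a, b')))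
| Tens_Zl c (a : A) (b : B) :
    tens_rel (PGen (c *: a, b)) (PMul (PCst c) (PGen (a, b)))
| Tens_Zr c (a : A) (b : B) :
    tens_rel (PGen (a, c *: b)) (PMul (PCst c) (PGen (a, b)))
| Tens_M (a a' : A) (b b' : B) :
    tens_rel (PGen (a * a', b * b')) (PMul (PGen (a, b)) (PGen (a', b')))
| Tens_1 : tens_rel (PGen (1, 1)) (PCst 1).

Definition tensalg := presalg tens_rel.

HB.instance Definition _ := GRing.PzRing.on tensalg.
HB.instance Definition _ := GRing.Lmodule.on tensalg.

Definition tens (a : A) (b : B) : tensalg := pgen tens_rel (a, b).

End TensorAlgebra.

Definition weyl_poly (K : fieldType) (n m : nat) :=
  tensalg (weyl K n) {mpoly K[m]}.

Section WeylPoly.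
Variables (K : fieldType) (n m : nat).
Local Notation P := {mpoly K[n]}.

HB.instance Definition _ := GRing.PzRing.on (weyl_poly K n m).
HB.instance Definition _ := GRing.Lmodule.on (weyl_poly K n m).

(* a (x) f acts on P_n as f(0) times the differential operator a; the action  *)
(* shows that 1 != 0.                                                         *)
Definition tens_gact (x : weyl K n * {mpoly K[m]}) (h : P) : P :=
  x.2.@[fun=> 0] *: weyl_act x.1 h.

Lemma tens_gact_linear x : linear (tens_gact x).
Proof.
case: x => a f c h h' /=; rewrite /tens_gact /=.
rewrite /weyl_act /presalg_act (pact_linear (@weyl_gact_linear K n)).
by rewrite scalerDr !scalerA mulrC.
Qed.

Lemma tens_gact_rel t u :
  tens_rel t u -> pact tens_gact t =1 pact tens_gact u.
Proof.
case=> {t u}.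
- move=> + + f h; elim/presalg_ind=> t; elim/presalg_ind=> u.
  by rewrite -piD /= /tens_gact !weyl_actE /= scalerDr.
- by move=> a f f' h /=; rewrite /tens_gact /= mevalD scalerDl.
- move=> c + f h; elim/presalg_ind=> t.
  rewrite -piZ /= /tens_gact !weyl_actE /=.
  by rewrite scalerA mulrC -scalerA.
- by move=> c a f h /=; rewrite /tens_gact /= mevalZ scalerA.
- move=> + + f f' h; elim/presalg_ind=> t; elim/presalg_ind=> u.
  rewrite -piM /= /tens_gact !weyl_actE /=.
  by rewrite mevalM pactZ ?scalerA //; apply: weyl_gact_linear.
- move=> h /=; rewrite /tens_gact /= meval1 (weyl_actE (PCst 1)) /=.
  by rewrite !scale1r.
Qed.

Lemma weyl_poly_oner_neq0 : (1 : weyl_poly K n m) != 0.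
Proof.
pose act : weyl_poly K n m -> P -> P := presalg_act tens_gact.
have actE := presalg_actE tens_gact_linear tens_gact_rel.
apply/eqP => eq10; have: act 1 1 = act 0 1 by rewrite eq10.
by rewrite /act !actE /= scale1r scale0r; apply/eqP/oner_neq0.
Qed.

HB.instance Definition _ :=
  GRing.PzSemiRing_isNonZero.Build (weyl_poly K n m) weyl_poly_oner_neq0.
HB.instance Definition _ :=
  GRing.Lmodule_isLalgebra.Build K (weyl_poly K n m) (@presalg_scalerAl _ _ _).
HB.instance Definition _ :=
  GRing.Lalgebra_isAlgebra.Build K (weyl_poly K n m) (@presalg_scalerAr _ _ _).

End WeylPoly.

Definition jacobian (K : fieldType) (m : nat) (f : 'I_m -> {mpoly K[m]}) :
  {mpoly K[m]} := \det (\matrix_(i < m, j < m) mderiv j (f i)).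

Definition in_Kstar (K : fieldType) (m : nat) (d : {mpoly K[m]}) : Prop :=
  exists2 c : K, c != 0 & d = c%:MP_[m].

(* Affirmative answers to the three questions. An automorphism is a bijective *)
(* K-algebra endomorphism. In JD, f i is sigma(x_i), which is in the centre   *)
(* P_m of A_n (x) P_m, read as a polynomial.                                  *)
Definition JD (K : fieldType) (n m : nat) : Prop :=
  forall (sigma : {lrmorphism weyl_poly K n m -> weyl_poly K n m})
         (f : 'I_m -> {mpoly K[m]}),
    (forall i, sigma (tens 1 'X_i) = tens 1 (f i)) ->
    in_Kstar (jacobian f) ->
    bijective sigma.

Definition JC (K : fieldType) (m : nat) : Prop :=
  forall sigma : {lrmorphism {mpoly K[m]} -> {mpoly K[m]}},
    in_Kstar (jacobian (fun i => sigma 'X_i)) ->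
    bijective sigma.

Definition DP (K : fieldType) (n : nat) : Prop :=
  forall sigma : {lrmorphism weyl K n -> weyl K n}, bijective sigma.

(* Main.v *)
From HB Require Import structures.
Require Import Defs.
From mathcomp Require Import all_boot all_order all_algebra.
From mathcomp Require Import zify.
From mathcomp.classical Require Import boolp.
From mathcomp.multinomials Require Import mpoly.
Set Implicit Arguments.
Unset Strict Implicit.
Unset Printing Implicit Defensive.
Import Order.TTheory GRing.Theory.
Local Open Scope ring_scope.
Local Open Scope quotient_scope.

(** For all n and m, JD for (n, m) is equivalent to JC for m together with DP
    for n; both halves of the theorem follow from this.

    From JD to JC and DP: an endomorphism tau of P_m extends to
    id (x) tau, and an endomorphism s of A_n extends to s (x) id.  The Jacobian
    of the first is that of tau, the Jacobian of the second is 1.  Bijectivity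
    descends to tau by comparing coefficients of normally ordered monomials
    (JD_JC), and to s by evaluating the central variables at 0 (JD_DP).

    From JC and DP to JD: let sigma be an endomorphism of A_n (x) P_m whose
    restriction tau to the centre P_m has Jacobian in K^*.  By JC, tau is an
    automorphism, so the image of sigma contains P_m.  Let y_1, ..., y_2n be
    the images under sigma of the generators q_1, ..., q_n, p_1, ..., p_n of A_n.
    They satisfy the Weyl relations again, so commutators with suitable +-y_i
    are commuting P_m-linear derivations D_1, ..., D_2n with D_i y_j = delta_ij.
    Integrating term by term (the Poincare lemma for polynomials), every element
    killed by all long enough words in the D_i is a polynomial in the y's with
    coefficients in the common kernel of the D_i (mmap_surj_nilpotent).  So it
    suffices that the common kernel is P_m and that each generator of A_n is
    killed by all words of some fixed length.

    Both facts are tested at points c of K^m, because K is infinite and an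
    element of A_n (x) P_m vanishing at all c is 0 (weyl_ev_eq0).  At c, sigma
    becomes an endomorphism s_c of A_n, which is an automorphism by DP, and the
    D_i become the images under s_c of the partial derivatives on normally
    ordered polynomials.  Hence the common kernel is K at each c, and a generator z
    is killed at c by all words longer than the degree of s_c^-1(z).  What is
    needed is that this degree is bounded independently of c: this is
    inverse_degree_bound, which bounds it in terms of the degrees of
    the s_c(z_i), and these are at most the degrees of the y_i.

    The degree bound is a dimension count.  Let g be a generator, b = s^-1(g) and
    r = 2n, and let k be the exponent of one variable in the leading monomial of b.
    The elements b^j z^alpha, with j and all exponents of alpha less than k, have
    distinct leading monomials, so they are k^(r + 1) independent elements.
    Their images g^j s(z)^alpha have degree less than C k, where C depends only
    on r and the degrees of the s(z_i), so they lie in a space of dimension at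
    most (C k)^r.  Hence k is at most C^r. *)

(** * Partial derivatives of polynomials *)

Section PartialDerivatives.
Variables (R : idomainType) (r : nat).
Hypothesis natU : forall k, (k.+1%:R : R) \is a GRing.unit.
Implicit Types (f g : {mpoly R[r]}) (m : 'X_{1..r}).

Lemma nat_neq0 k : (k.+1%:R : R) != 0.
Proof. by apply: contraTneq (natU k) => ->; rewrite unitr0. Qed.

Lemma natM_eq0 k (x : R) : x *+ k.+1 = 0 -> x = 0.
Proof.
by move/eqP; rewrite -mulr_natr mulf_eq0 (negPf (nat_neq0 k)) orbF => /eqP.
Qed.

Lemma mderiv_eq0 f : (forall i, f^`M(i) = 0) -> f = (f@_0)%:MP.
Proof.
move=> df0; apply/mpolyP => m; rewrite mcoeffC.
have [->|m0] := eqVneq m 0%MM; first by rewrite mulr1.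
rewrite mulr0; move: m0; rewrite -mdeg_eq0 mdegE sum_nat_eq0.
case/forallPn => i /= mi0.
have mE : m = (m - U_(i) + U_(i))%MM.
  apply/mnmP => j; rewrite mnmDE mnmBE mnm1E.
  by have [<-|_] := eqVneq i j; rewrite ?subn0 ?addn0 // subnK // lt0n.
have /(congr1 (mcoeff (m - U_(i))%MM)) := df0 i.
by rewrite mcoeff_deriv mcoeff0 -mE => /natM_eq0.
Qed.

Lemma msize_leP k f :
  reflect (forall m, f@_m != 0 -> (mdeg m < k)%N) (msize f <= k)%N.
Proof.
apply: (iffP idP) => [lefk m|H].
  by rewrite -mcoeff_msupp => /msize_mdeg_lt /leq_trans; apply.
rewrite msizeE; apply/bigmax_leqP_seq => m; rewrite mcoeff_msupp => fm _.
exact: H.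
Qed.

Lemma msize_mderiv i f : (msize f^`M(i) <= (msize f).-1)%N.
Proof.
apply/msize_leP => m; rewrite mcoeff_deriv => fm.
have : f@_(m + U_(i)) != 0 by apply: contraNneq fm => ->; rewrite mul0rn.
rewrite -mcoeff_msupp => /msize_mdeg_lt; rewrite mdegD mdeg1 addn1.
by case: (msize f).
Qed.

Lemma msizeM_pred f g : (msize (f * g) <= (msize f + msize g).-1)%N.
Proof.
have [->|f0] := eqVneq f 0; first by rewrite mul0r mmeasure0.
have [->|g0] := eqVneq g 0; first by rewrite mulr0 mmeasure0.
by rewrite msizeM.
Qed.

(** The homotopy operator of the Poincare lemma, the integral over [0, 1] of
    t^(c - 1) f(t x): it divides each monomial X^m by |m| + c. *)
Definition homog_div c f : {mpoly R[r]} :=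
  \sum_(m <- msupp f) ((mdeg m + c)%:R^-1 * f@_m) *: 'X_[m].

Lemma mcoeff_homog_div c f m : (homog_div c f)@_m = (mdeg m + c)%:R^-1 * f@_m.
Proof.
rewrite /homog_div linear_sum /=.
under eq_bigr do rewrite mcoeffZ mcoeffX.
case: (boolP (m \in msupp f)) => mf.
  rewrite (bigD1_seq m) ?msupp_uniq //= eqxx mulr1 big1 ?addr0 // => m' m'm.
  by rewrite (negPf m'm) mulr0.
rewrite (memN_msupp_eq0 mf) mulr0 big_seq big1 // => m' m'f.
by case: eqVneq mf => [<-|_]; rewrite ?m'f // !mulr0.
Qed.

Lemma mderiv_homog_div c i f : (homog_div c f)^`M(i) = homog_div c.+1 f^`M(i).
Proof.
apply/mpolyP => m; rewrite mcoeff_deriv !mcoeff_homog_div mcoeff_deriv.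
by rewrite mdegD mdeg1 addn1 addSnnS mulrnAr.
Qed.

(** Euler's identity, coefficient by coefficient. *)
Lemma mcoeff_euler f m : (\sum_i 'X_i * f^`M(i))@_m = f@_m *+ mdeg m.
Proof.
have mon m' : \sum_i 'X_i * ('X_[R, m'])^`M(i) = 'X_[m'] *+ mdeg m'.
  rewrite mdegE -sumrMnr; apply: eq_bigr => i _.
  rewrite mderivX scaler_nat mulrnAr -mpolyXD.
  case E: (m' i) => [|k]; first by rewrite !mulr0n.
  congr (_ *+ _); congr ('X_[_]); apply/mnmP => j.
  rewrite mnmDE mnmBE mnm1E.
  by case: eqP => [<-|_] /=; rewrite ?add0n ?subn0 // E add1n subn1.
have -> : \sum_i 'X_i * f^`M(i) =
    \sum_(m' <- msupp f) f@_m' *: ('X_[m'] *+ mdeg m').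
  rewrite {1}[f]mpolyE; under eq_bigr do rewrite linear_sum mulr_sumr.
  rewrite exchange_big /=; apply: eq_bigr => m' _; rewrite -mon scaler_sumr.
  by apply: eq_bigr => i _; rewrite linearZ -scalerAr.
rewrite [in RHS](mpolyE f) !linear_sum /= -sumrMnl; apply: eq_bigr => m' _.
rewrite !mcoeffZ mcoeffMn !mcoeffX.
by case: eqP => [->|_]; rewrite ?mulrnAr // !(mulr0n, mul0rn, mulr0).
Qed.

(** The Poincare lemma in degree 1.  The primitive is the sum of the X_i S(F_i),
    with S dividing X^m by |m| + 1: by closedness, its j-th derivative is
    S(F_j) plus the Euler operator applied to S(F_j), which is F_j. *)
Lemma mpoly_poincare (F : 'I_r -> {mpoly R[r]}) :
  (forall i j, (F i)^`M(j) = (F j)^`M(i)) ->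
  exists G, forall i, G^`M(i) = F i.
Proof.
move=> Fij; exists (\sum_i 'X_i * homog_div 1 (F i)) => j.
rewrite linear_sum /=.
under eq_bigr => i _ do
  rewrite mderivM mderiv_homog_div Fij -mderiv_homog_div.
rewrite big_split /= (bigD1 j) //= big1 ?addr0 => [|i ij]; last first.
  rewrite mderivX mnm1E (negPf ij) scale0r mul0r //.
rewrite mderivX mnm1E eqxx scale1r.
have -> : (U_(j) - U_(j) = 0 :> 'X_{1..r})%MM.
  by apply/mnmP=> k; rewrite mnmBE subnn mnm0E.
rewrite mpolyX0 mul1r; apply/mpolyP => m.
rewrite mcoeffD mcoeff_euler mcoeff_homog_div addn1 -mulrS -[LHS]mulr_natl mulrA.
by rewrite mulrV ?mul1r.
Qed.

End PartialDerivatives.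

(** * Derivations dual to a system of generators *)

Section Derivations.
Variables (R : idomainType) (A : nzRingType) (inc : {rmorphism R -> A}).
Variables (r : nat) (z : 'I_r -> A).

Section OneDerivation.
Variables (i : 'I_r) (D : A -> A).
Hypothesis DD : {morph D : a b / a + b}.
Hypothesis DM : forall a b, D (a * b) = D a * b + a * D b.
Hypothesis Dinc : forall c, D (inc c) = 0.
Hypothesis Dz : forall k, D (z k) = (i == k)%:R.

Let D1 : D 1 = 0. Proof. by rewrite -(rmorph1 inc) Dinc. Qed.

Let D0 : D 0 = 0. Proof. by rewrite -[in LHS](rmorph0 inc) Dinc. Qed.

Let Dexp k e : D (z k ^+ e) = ((i == k) * e)%:R * z k ^+ e.-1.
Proof.
elim: e => [|e IHe]; first by rewrite expr0 D1 muln0 mul0r.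
rewrite exprS DM IHe Dz; case: eqP => [_|_]; last by rewrite !mul0r mulr0 addr0.
rewrite !mul1n mul1r mulr_natl mulrnAr mulr_natl mulrS.
by case: e {IHe} => [|e]; rewrite ?mulr0n // -exprS.
Qed.

Let Dprod (m : 'X_{1..r}) (s : seq 'I_r) : uniq s ->
  D (\prod_(k <- s) z k ^+ m k) =
  ((i \in s) * m i)%:R * \prod_(k <- s) z k ^+ (m - U_(i))%MM k.
Proof.
elim: s => [_|k s IHs /= /andP[ks us]].
  by rewrite !big_nil D1 mul0r.
rewrite !big_cons DM Dexp IHs // inE mnmBE mnm1E.
have [eik|ik] := eqVneq i k; last first.
  by rewrite mul0n !mul0r add0r subn0 orFb mulr_natl mulrnAr mulr_natl.
rewrite -eik in ks *; rewrite (negPf ks) !mul0n mul0r mulr0 addr0 !mul1n subn1 -mulrA.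
congr (_ * (_ * _)); apply: eq_big_seq => j js; rewrite mnmBE mnm1E.
by case: eqVneq js ks => [->->|]; rewrite ?subn0.
Qed.

Lemma derivation_mmap1 (m : 'X_{1..r}) :
  D (mmap1 z m) = (m i)%:R * mmap1 z (m - U_(i)).
Proof. by rewrite /mmap1 Dprod ?index_enum_uniq // mem_index_enum mul1n. Qed.

(** A derivation that kills the coefficients and is dual to the i-th generator
    acts on ordered polynomials in the generators as the i-th partial derivative,
    although the generators need not commute. *)
Lemma derivation_mmap F : D (mmap inc z F) = mmap inc z F^`M(i).
Proof.
have Dsum (T : Type) (s : seq T) (E : T -> A) :
    D (\sum_(x <- s) E x) = \sum_(x <- s) D (E x).
  by elim: s => [|x s IHs]; rewrite ?big_nil // !big_cons DD IHs.
rewrite {1}/mmap Dsum [in RHS](mpolyE F) linear_sum raddf_sum /=.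
apply: eq_bigr => m _; rewrite DM Dinc mul0r add0r derivation_mmap1.
by rewrite mderivZ mmapZ mderivX mmapZ mmapX rmorph_nat.
Qed.

End OneDerivation.

Variable D : 'I_r -> A -> A.
Hypothesis D_mmap : forall i F, D i (mmap inc z F) = mmap inc z F^`M(i).
Hypothesis DD : forall i, {morph D i : a b / a + b}.
Hypothesis natU : forall k, (k.+1%:R : R) \is a GRing.unit.
Hypothesis inc_inj : injective inc.

Let D0 i : D i 0 = 0.
Proof. by apply: (addrI (D i 0)); rewrite -DD !addr0. Qed.

(** A polynomial of least degree in the kernel has all its partial derivatives
    in the kernel, so it is constant. *)
Lemma mmap_inj : injective (mmap inc z).
Proof.
suff ker k F : (msize F <= k)%N -> mmap inc z F = 0 -> F = 0.
  move=> F G eqFG; apply/eqP; rewrite -subr_eq0; apply/eqP.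
  by apply: (ker _ _ (leqnn _)); rewrite raddfB /= eqFG subrr.
elim: k F => [|k IHk] F; first by rewrite leqn0 mmeasure_poly_eq0 => /eqP.
move=> leF F0; have dF0 i : F^`M(i) = 0.
  apply: IHk; last by rewrite -D_mmap F0 D0.
  by apply: leq_trans (msize_mderiv _ _) _; case: (msize F) leF.
move: F0; rewrite (mderiv_eq0 natU dF0) mmapC -(rmorph0 inc) => /inc_inj ->.
by rewrite mpolyC0.
Qed.

Hypothesis DC : forall i j a, D i (D j a) = D j (D i a).
Hypothesis kerD : forall a, (forall i, D i a = 0) -> exists c, a = inc c.

(** By induction on k each D_i a is a polynomial F_i in the generators.  Since
    the D_i commute, the F_i form a closed system; a differs from a primitive of
    it by an element of the common kernel. *)
Lemma mmap_surj_nilpotent k a :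
  (forall w : k.-tuple 'I_r, foldr D a w = 0) -> exists F, a = mmap inc z F.
Proof.
elim: k a => [|k IHk] a Da.
  by exists 0; rewrite mmap0; have := Da [tuple].
have DaI i : exists F, D i a = mmap inc z F.
  apply: IHk => w; have := Da [tuple of rcons w i].
  by rewrite /= foldr_rcons.
have [F FE] := choice DaI.
have [i j|G GE] := @mpoly_poincare _ _ natU F.
  by apply: mmap_inj; rewrite -!D_mmap -!FE DC.
have [|c cE] := kerD (a := a - mmap inc z G).
  move=> i; apply: (addIr (D i (mmap inc z G))).
  by rewrite -DD subrK add0r D_mmap GE FE.
by exists (c%:MP + G); rewrite mmapD mmapC /= -cE subrK.
Qed.

End Derivations.

(** * Polynomials vanishing at all points *)

Section Vanishing.
Variables (K : fieldType) (m : nat).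
Hypothesis natU : forall k, (k.+1%:R : K) \is a GRing.unit.

Lemma poly_eq0_of_roots (g : {poly K}) : (forall t, g.[t] = 0) -> g = 0.
Proof.
move=> g0; apply/eqP; apply/negPn/negP => gn0.
pose rs := [seq k%:R : K | k <- iota 0 (size g)].
have : (size rs < size g)%N.
  apply: max_poly_roots => //; first by apply/allP => x _; rewrite /root g0.
  rewrite map_inj_in_uniq ?iota_uniq // => k l _ _.
  wlog le_kl : k l / (k <= l)%N.
    by move=> wl; case/orP: (leq_total k l) => [/wl|/wl H /esym/H].
  move/eqP; rewrite eq_sym -subr_eq0 -natrB //.
  case E: (l - k)%N => [|e]; first by move=> _; lia.
  by rewrite (negPf (nat_neq0 natU _)).
by rewrite size_map size_iota ltnn.
Qed.

(** Restricting f to lines shows that its partial derivatives vanish everywhere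
    too, so by induction on the degree they are 0 and f is constant. *)
Lemma mpoly_eq0_of_meval (f : {mpoly K[m]}) : (forall c, f.@[c] = 0) -> f = 0.
Proof.
have [k] := ubnP (msize f); elim: k f => // k IHk f lek f0.
have df0 i : f^`M(i) = 0.
  have [f_eq0|fn0] := eqVneq f 0; first by rewrite f_eq0 linear0.
  apply: IHk => [|c].
    apply: leq_ltn_trans (msize_mderiv _ _) _.
    by rewrite -(mmeasure_poly_eq0 mdeg) in fn0; case: (msize f) lek fn0.
  (* The line through c in the direction i; f restricted to it is the value of
     mmap, on which the i-th partial derivative acts as d/dt. *)
  pose line j : {poly K} := (c j)%:P + (i == j)%:R * 'X.
  have lineE t g : (mmap (@polyC K) line g).[t] = g.@[fun j => (c j + (i == j)%:R * t)].
    rewrite /meval /mmap horner_sum; apply: eq_bigr => l _.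
    rewrite hornerM hornerC /mmap1 horner_prod; congr (_ * _).
    apply: eq_bigr => j _; rewrite horner_exp !hornerE.
    by case: eqP; rewrite !hornerE.
  have g0 : mmap (@polyC K) line f = 0.
    by apply: poly_eq0_of_roots => t; rewrite lineE.
  have : mmap (@polyC K) line f^`M(i) = 0.
    rewrite -(@derivation_mmap _ _ _ _ _ _ (@deriv K)) ?g0 ?deriv0 //.
    - exact: derivD.
    - exact: derivM.
    - exact: derivC.
    - move=> j; rewrite derivD derivC add0r derivM derivX mulr1.
      by rewrite -polyC_natr derivC mul0r add0r.
  move/(congr1 (fun g => g.[0])); rewrite lineE horner0 => <-.
  by apply: meval_eq => j; rewrite mulr0 addr0.
have := f0 (fun=> 0); rewrite (mderiv_eq0 natU df0) mevalC => ->.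
by rewrite mpolyC0.
Qed.

End Vanishing.

(** * Systems satisfying the Weyl relations *)

Lemma prod_commuting_mul (A : nzRingType) n (x : 'I_n -> A) j e :
  (forall i k, x i * x k = x k * x i) ->
  x j * \prod_i x i ^+ e i = \prod_i x i ^+ ((i == j) + e i).
Proof.
move=> xC.
have xXC i k d : x i * x k ^+ d = x k ^+ d * x i by apply/commrX/xC.
suff H (s : seq 'I_n) : uniq s ->
    x j ^+ (j \in s) * \prod_(i <- s) x i ^+ e i =
    \prod_(i <- s) x i ^+ ((i == j) + e i).
  by rewrite -(H _ (index_enum_uniq _)) mem_index_enum.
elim: s => [_|i s IHs /= /andP[si us]]; first by rewrite !big_nil mulr1.
rewrite !big_cons -IHs // inE [j == i]eq_sym.
have [eij|ij] := eqVneq i j.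
  by rewrite -eij (negPf si) expr0 mul1r mulrA -exprD.
rewrite orFb add0n !mulrA; congr (_ * _).
by case: (j \in s); rewrite ?mulr1 ?mul1r // xXC.
Qed.

Section WeylSystem.
Variables (R : idomainType) (A : nzRingType) (inc : {rmorphism R -> A}).
Hypothesis natU : forall k, (k.+1%:R : R) \is a GRing.unit.
Hypothesis incC : forall c a, inc c * a = a * inc c.
Variables (n : nat) (q p : 'I_n -> A).
Hypothesis pq : forall i j, p i * q j - q j * p i = (i == j)%:R.
Hypothesis pp : forall i j, p i * p j - p j * p i = 0.
Hypothesis qq : forall i j, q i * q j - q j * q i = 0.

(** The variables of {mpoly R[n + n]} index the generators q_1, ..., q_n,
    p_1, ..., p_n in this order, so that mmap inc weylz is normal ordering. *)
Definition weylz (i : 'I_(n + n)) : A :=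
  match split i with inl j => q j | inr j => p j end.
(** The generator conjugate to weylz i, signed so that the commutator with it is
    the derivation dual to weylz i. *)
Definition weylw (i : 'I_(n + n)) : A :=
  match split i with inl j => p j | inr j => - q j end.
Definition weylD i a := weylw i * a - a * weylw i.

Notation z := weylz.
Notation w := weylw.
Notation D := weylD.
Notation Phi := (mmap inc z).

Lemma weylz_lshift j : z (lshift n j) = q j.
Proof. by rewrite /z (unsplitK (inl j)). Qed.
Lemma weylz_rshift j : z (rshift n j) = p j.
Proof. by rewrite /z (unsplitK (inr j)). Qed.
Lemma weylw_lshift j : w (lshift n j) = p j.
Proof. by rewrite /w (unsplitK (inl j)). Qed.
Lemma weylw_rshift j : w (rshift n j) = - q j.
Proof. by rewrite /w (unsplitK (inr j)). Qed.

Let weylE := (weylz_lshift, weylz_rshift, weylw_lshift, weylw_rshift).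

Let ppC i j : p i * p j = p j * p i.
Proof. by apply/eqP; rewrite -subr_eq0 pp. Qed.
Let qqC i j : q i * q j = q j * q i.
Proof. by apply/eqP; rewrite -subr_eq0 qq. Qed.

Lemma weylD_z i k : D i (z k) = (i == k)%:R.
Proof.
rewrite /D; case: (split_ordP i) => j ->; case: (split_ordP k) => l ->;
  rewrite !weylE ?eq_shift.
- exact: pq.
- exact: pp.
- by rewrite mulNr mulrN opprK (qqC l) addNr.
- by rewrite mulNr mulrN opprK addrC pq eq_sym.
Qed.

Lemma weylD_add i : {morph D i : a b / a + b}.
Proof. by move=> a b; rewrite /D mulrDr mulrDl opprD addrACA. Qed.

Lemma weylD_mul i a b : D i (a * b) = D i a * b + a * D i b.
Proof. by rewrite /D mulrBl mulrBr !mulrA addrA subrK. Qed.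

Lemma weylD_inc i c : D i (inc c) = 0.
Proof. by rewrite /D incC subrr. Qed.

Lemma weylD_mmap i F : D i (Phi F) = Phi F^`M(i).
Proof.
apply: derivation_mmap; [exact: weylD_add|exact: weylD_mul|exact: weylD_inc|].
exact: weylD_z.
Qed.

(** The commutator of two generators is central. *)
Lemma weylD_comm i j a : D i (D j a) = D j (D i a).
Proof.
have [c wwE] : exists c, D i (w j) = inc c.
  rewrite /D; case: (split_ordP i) => k ->; case: (split_ordP j) => l ->;
    rewrite !weylE.
  - by exists 0; rewrite rmorph0 pp.
  - exists (- (k == l)%:R).
    by rewrite rmorphN rmorph_nat -pq opprB mulrN mulNr opprK addrC.
  - exists (k == l)%:R.
    by rewrite rmorph_nat mulrN mulNr opprK addrC pq eq_sym.
  - by exists 0; rewrite rmorph0 !mulrNN (qqC l) subrr.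
have DN b : D i (- b) = - D i b by rewrite /D mulrN mulNr -opprB opprK addrC.
rewrite -[D j a]/(w j * a - a * w j) -[RHS]/(w j * D i a - D i a * w j).
rewrite weylD_add DN !weylD_mul wwE incC opprD [- _ - a * _]addrC.
by rewrite addrACA subrr add0r.
Qed.

(** The correction to normal ordering after left multiplication by a generator:
    moving p_j to the right of the q's differentiates with respect to q_j. *)
Definition weyl_corr (i : 'I_(n + n)) (f : {mpoly R[n + n]}) : {mpoly R[n + n]} :=
  match split i with inl _ => 0 | inr j => f^`M(lshift n j) end.

Lemma weyl_corr_lshift j f : weyl_corr (lshift n j) f = 0.
Proof. by rewrite /weyl_corr (unsplitK (inl j)). Qed.
Lemma weyl_corr_rshift j f : weyl_corr (rshift n j) f = f^`M(lshift n j).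
Proof. by rewrite /weyl_corr (unsplitK (inr j)). Qed.

Let mmap1_split m : mmap1 z m =
  (\prod_i q i ^+ m (lshift n i)) * (\prod_i p i ^+ m (rshift n i)).
Proof.
rewrite /mmap1 big_split_ord /=.
by congr (_ * _); apply: eq_bigr => i _; rewrite !weylE.
Qed.


Lemma weylz_mul i f : z i * Phi f = Phi ('X_i * f + weyl_corr i f).
Proof.
case: (split_ordP i) => j ->; rewrite !weylE.
  rewrite weyl_corr_lshift addr0 [f in LHS]mpolyE [f in RHS]mpolyE.
  rewrite [in RHS]mulr_sumr !raddf_sum /= mulr_sumr; apply: eq_bigr => m _.
  rewrite -scalerAr !mmapZ mulrA -incC -mulrA -mpolyXD !mmapX !mmap1_split.
  congr (_ * _); rewrite mulrA prod_commuting_mul //; congr (_ * _); apply: eq_bigr => k _.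
    by rewrite mnmDE mnm1E eq_shift eq_sym.
  by rewrite mnmDE mnm1E eq_shift.
rewrite weyl_corr_rshift mmapD -weylD_mmap /D weylE addrC -[LHS](subrK (Phi f * p j)).
congr (_ + _).
rewrite [f in LHS]mpolyE [f in RHS]mpolyE.
rewrite [in RHS]mulr_sumr !raddf_sum /= mulr_suml; apply: eq_bigr => m _.
rewrite -scalerAr !mmapZ -mulrA -mpolyXD !mmapX !mmap1_split.
congr (_ * _); rewrite -mulrA.
have -> : (\prod_i p i ^+ m (rshift n i)) * p j = p j * \prod_i p i ^+ m (rshift n i).
  rewrite -[RHS]/(GRing.mul _ _).
  elim/big_rec: _ => [|k b _ IHb]; first by rewrite mulr1 mul1r.
  rewrite -mulrA IHb !mulrA; congr (_ * _).
  exact/esym/commrX/ppC.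
rewrite prod_commuting_mul //; congr (_ * _); apply: eq_bigr => k _.
  by rewrite mnmDE mnm1E eq_shift.
by rewrite mnmDE mnm1E eq_shift eq_sym.
Qed.

(** The associated graded ring of the degree filtration is commutative: the
    product of normally ordered polynomials is their commutative product up to
    terms of lower degree. *)
Lemma mmap_mul_lead f g : exists2 e,
  Phi f * Phi g = Phi (f * g + e) & (msize e <= (msize f + msize g).-2)%N.
Proof.
suff mon d m g' : (mdeg m <= d)%N -> exists2 e,
    Phi 'X_[m] * Phi g' = Phi ('X_[m] * g' + e) & (msize e <= mdeg m + msize g' - 1)%N.
  have /choice[e eP] : forall m, exists e,
      Phi 'X_[m] * Phi g = Phi ('X_[m] * g + e) /\ (msize e <= mdeg m + msize g - 1)%N.
    by move=> m; have [e] := mon _ m g (leqnn _); exists e.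
  exists (\sum_(m <- msupp f) f@_m *: e m).
    rewrite [f in f * g]mpolyE [X in Phi (X + _)]mulr_suml -big_split.
    rewrite [f in LHS]mpolyE !raddf_sum /= mulr_suml; apply: eq_bigr => m _.
    by rewrite mmapZ -mulrA (eP m).1 -scalerAl -scalerDr mmapZ.
  apply: leq_trans (msize_sum _ _ _) _; apply/bigmax_leqP_seq => m mf _.
  apply: leq_trans (msizeZ_le _ _) (leq_trans (eP m).2 _).
  by have := msize_mdeg_lt mf; lia.
elim: d m g' => [|d IHd] m g'.
  rewrite leqn0 mdeg_eq0 => /eqP->; exists 0; last by rewrite mmeasure0.
  by rewrite mpolyX0 addr0 mul1r -mpolyC1 mmapC /= rmorph1 mul1r.
have [/IHd //|] := leqP (mdeg m) d => dm md.
have [i mi0] : exists i, m i != 0%N.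
  apply/existsP; apply: contraTT (leq_trans (ltn0Sn d) dm).
  rewrite negb_exists -leqNgt leqn0 mdegE sum_nat_eq0 => /forallP H.
  by apply/forallP => k /=; have := H k; rewrite negbK.
have mE : m = (U_(i) + (m - U_(i)))%MM.
  apply/mnmP => j; rewrite mnmDE mnmBE mnm1E.
  by have [<-|_] := eqVneq i j; rewrite ?subn0 ?add0n // subnKC // lt0n.
have degm : mdeg m = (mdeg (m - U_(i))).+1.
  by rewrite {1}mE mdegD mdeg1 add1n.
set m1 := (m - U_(i))%MM in mE degm.
have [e1 e1E e1s] := IHd m1 g' ltac:(lia).
(* z_i X^m1 is X^m plus a correction, and e2 is what the correction contributes. *)
have [e2 e2E e2s] : exists2 e2, Phi (weyl_corr i 'X_[m1]) * Phi g' = Phi e2 &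
    (msize e2 <= mdeg m + msize g' - 1)%N.
  case: (split_ordP i) => j ij; rewrite ij ?weyl_corr_lshift ?weyl_corr_rshift.
    by exists 0; rewrite ?mmeasure0 // !mmap0 mul0r.
  rewrite mderivX mmapZ; set m2 := (m1 - _)%MM.
  have m2d : (mdeg m2 <= mdeg m1)%N by exact: mdegB.
  have [e eE es] := IHd m2 g' ltac:(lia).
  exists ((m1 (lshift n j))%:R *: ('X_[m2] * g' + e)).
    by rewrite mmapZ -mulrA eE.
  apply: leq_trans (msizeZ_le _ _) (leq_trans (msizeD_le _ _) _).
  rewrite geq_max; apply/andP; split; last by lia.
  have := msizeM_pred 'X_[m2] g'; rewrite msizeX; lia.
exists ('X_i * e1 + weyl_corr i ('X_[m1] * g' + e1) - e2).
  have -> : Phi 'X_[m] = z i * Phi 'X_[m1] - Phi (weyl_corr i 'X_[m1]).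
    by rewrite weylz_mul -mpolyXD -mE mmapD addrK.
  rewrite mulrBl -mulrA e1E e2E weylz_mul -raddfB /=; congr (Phi _).
  by rewrite mE mpolyXD mulrDr !mulrA !addrA.
apply: leq_trans (msizeD_le _ _) _; rewrite geq_max msizeN e2s andbT.
apply: leq_trans (msizeD_le _ _) _; rewrite geq_max; apply/andP; split.
  have [->|e10] := eqVneq e1 0; first by rewrite mulr0 mmeasure0.
  move: e10 e1s; rewrite -(mmeasure_poly_eq0 mdeg).
  by have := msizeM_pred 'X_i e1; rewrite msizeX mdeg1; lia.
case: (split_ordP i) => j ij; rewrite ij ?weyl_corr_lshift ?weyl_corr_rshift.
  by rewrite mmeasure0.
apply: leq_trans (msize_mderiv _ _) (leq_trans (leq_pred _) _).
apply: leq_trans (msizeD_le _ _) _; rewrite geq_max; apply/andP; split.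
  by have := msizeM_pred 'X_[m1] g'; rewrite msizeX; lia.
by lia.
Qed.

(** Such a form a subring; as soon as it contains ring generators, every element
    is a normally ordered polynomial. *)
Definition stabilizes a := forall f, exists g, a * Phi f = Phi g.

Lemma stabilizesD a b : stabilizes a -> stabilizes b -> stabilizes (a + b).
Proof.
move=> sa sb f; have [[g gE] [h hE]] := (sa f, sb f).
by exists (g + h); rewrite mulrDl gE hE mmapD.
Qed.

Lemma stabilizesM a b : stabilizes a -> stabilizes b -> stabilizes (a * b).
Proof.
move=> sa sb f; have [g gE] := sb f; have [h hE] := sa g.
by exists h; rewrite -mulrA gE hE.
Qed.

Lemma stabilizes_inc c : stabilizes (inc c).
Proof. by move=> f; exists (c *: f); rewrite mmapZ. Qed.

Lemma stabilizes_z i : stabilizes (z i).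
Proof. by move=> f; rewrite weylz_mul; eexists. Qed.

Lemma stabilizes_mmap a : stabilizes a -> exists f, a = Phi f.
Proof.
by move/(_ 1) => [g]; rewrite -{1}mpolyC1 mmapC /= rmorph1 mulr1 => ->; exists g.
Qed.

Lemma weyl_mmap_inj : injective inc -> injective Phi.
Proof.
by move=> inc_inj; apply: mmap_inj natU inc_inj; [exact: weylD_mmap|exact: weylD_add].
Qed.

End WeylSystem.

(** * Presented algebras and the tensor product *)

Lemma lrmorphism_of (K : fieldType) (A B : algType K) (f : A -> B) :
  {morph f : a b / a + b} -> {morph f : a b / a * b} -> f 1 = 1 ->
  scalable f -> exists g : {lrmorphism A -> B}, g =1 f.
Proof.
move=> fD fM f1 fZ.
have fB : zmod_morphism f.
  move=> a b; apply: (addIr (f b)).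
  by rewrite -fD !subrK.
have fMM : monoid_morphism f by split.
pose g : {lrmorphism A -> B} := HB.pack_for (@GRing.LRMorphism.type K A B *:%R) f
  (GRing.isZmodMorphism.Build A B f fB)
  (GRing.isMonoidMorphism.Build A B f fMM)
  (GRing.isScalable.Build K A B *:%R f fZ).
by exists g.
Qed.

Section Presented.
Variables (K : fieldType) (X : Type) (rel : pterm K X -> pterm K X -> Prop).

Lemma presalg_gen_ind (P : presalg rel -> Prop) :
  (forall x, P (pgen rel x)) -> (forall c : K, P (c *: (1 : presalg rel))) ->
  (forall a b, P a -> P b -> P (a + b)) ->
  (forall a b, P a -> P b -> P (a * b)) -> forall a, P a.
Proof.
move=> Pg Pc PD PM; apply: presalg_ind.
elim=> [x|c|t Pt u Pu|t Pt u Pu]; first exact: Pg.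
- by rewrite piC.
- by rewrite piD; apply: PD.
- by rewrite piM; apply: PM.
Qed.

End Presented.

Section WeylAlg.
Variables (K : fieldType) (n : nat).
Notation W := (weyl K n).

Lemma weyl_gen_ind (P : W -> Prop) :
  (forall i, P (weylz (@weylQ K n) (@weylP K n) i)) -> (forall c : K, P c%:A) ->
  (forall a b, P a -> P b -> P (a + b)) ->
  (forall a b, P a -> P b -> P (a * b)) -> forall a, P a.
Proof.
move=> Pz; apply: presalg_gen_ind => -[j|j].
  by have := Pz (lshift n j); rewrite weylz_lshift.
by have := Pz (rshift n j); rewrite weylz_rshift.
Qed.

End WeylAlg.

Section TensorMaps.
Variables (K : fieldType) (n m : nat).
Notation W := (weyl K n).
Notation P := {mpoly K[m]}.
Notation T := (weyl_poly K n m).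

Let tens_eq t u : tens_rel t u ->
  \pi_(presalg (@tens_rel K W P)) t = \pi_(presalg (@tens_rel K W P)) u.
Proof. by move=> tu; apply/presalg_eqP/PC_rel. Qed.

(** tens, with values in the type that carries the algebra structure. *)
Definition wtens (a : W) (f : P) : T := tens a f.

Lemma tensDl a a' f : wtens (a + a') f = wtens a f + wtens a' f.
Proof. by rewrite /wtens /tens /pgen (tens_eq (Tens_Dl _ _ _)) piD. Qed.
Lemma tensDr a f f' : wtens a (f + f') = wtens a f + wtens a f'.
Proof. by rewrite /wtens /tens /pgen (tens_eq (Tens_Dr _ _ _)) piD. Qed.
Lemma tensZl c a f : wtens (c *: a) f = c *: wtens a f.
Proof. by rewrite /wtens /tens /pgen (tens_eq (Tens_Zl _ _ _)) piZ. Qed.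
Lemma tensZr c a f : wtens a (c *: f) = c *: wtens a f.
Proof. by rewrite /wtens /tens /pgen (tens_eq (Tens_Zr _ _ _)) piZ. Qed.
Lemma tensM a a' f f' : wtens (a * a') (f * f') = wtens a f * wtens a' f'.
Proof. by rewrite /wtens /tens /pgen (tens_eq (Tens_M _ _ _ _)) piM. Qed.
Lemma tens11 : wtens 1 1 = 1.
Proof. by rewrite /wtens /tens /pgen (tens_eq (Tens_1 _ _)). Qed.

Lemma weyl_poly_gen_ind (Q : T -> Prop) :
  (forall a f, Q (wtens a f)) -> (forall c : K, Q c%:A) ->
  (forall a b, Q a -> Q b -> Q (a + b)) ->
  (forall a b, Q a -> Q b -> Q (a * b)) -> forall a, Q a.
Proof. by move=> Qt; apply: presalg_gen_ind => -[a f]; apply: Qt. Qed.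

Lemma weyl_poly_lift (B : algType K) (al : {lrmorphism W -> B})
    (be : {rmorphism P -> B}) :
  scalable be -> (forall a f, al a * be f = be f * al a) ->
  exists F : {lrmorphism T -> B}, forall a f, F (wtens a f) = al a * be f.
Proof.
move=> beZ comm.
pose g (x : W * P) := al x.1 * be x.2.
have [t u|F [[FD FM F1 FZ Fg] _]] := @presalg_univ K _ (@tens_rel K W P) B g.
  case=> /=; rewrite /g /=.
  - by move=> a a' f; rewrite raddfD mulrDl.
  - by move=> a f f'; rewrite raddfD mulrDr.
  - by move=> c a f; rewrite linearZ -!scalerAl mul1r.
  - by move=> c a f; rewrite beZ -!scalerAr -scalerAl mul1r.
  - move=> a a' f f'; rewrite !rmorphM -!mulrA; congr (_ * _).
    by rewrite !mulrA comm.
  - by rewrite !rmorph1 mulr1 scale1r.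
have [F' F'E] := @lrmorphism_of K T B F FD FM F1 FZ.
by exists F' => a f; rewrite F'E Fg.
Qed.

Definition tens_weyl (a : W) : T := wtens a 1.
Definition tens_poly (f : P) : T := wtens 1 f.


Let tens_weyl_zmod : zmod_morphism tens_weyl.
Proof. by move=> a b; rewrite /tens_weyl -scaleN1r tensDl tensZl scaleN1r. Qed.
Let tens_weyl_monoid : monoid_morphism tens_weyl.
Proof. by split=> [|a b]; rewrite /tens_weyl ?tens11 // -tensM mulr1. Qed.
Let tens_weyl_scale : scalable tens_weyl.
Proof. by move=> c a; apply: tensZl. Qed.
HB.instance Definition _ := GRing.isZmodMorphism.Build W T tens_weyl tens_weyl_zmod.
HB.instance Definition _ := GRing.isMonoidMorphism.Build W T tens_weyl tens_weyl_monoid.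
HB.instance Definition _ := GRing.isScalable.Build K W T *:%R tens_weyl tens_weyl_scale.

Let tens_poly_zmod : zmod_morphism tens_poly.
Proof. by move=> a b; rewrite /tens_poly -scaleN1r tensDr tensZr scaleN1r. Qed.
Let tens_poly_monoid : monoid_morphism tens_poly.
Proof. by split=> [|a b]; rewrite /tens_poly ?tens11 // -tensM mulr1. Qed.
Let tens_poly_scale : scalable tens_poly.
Proof. by move=> c a; apply: tensZr. Qed.
HB.instance Definition _ := GRing.isZmodMorphism.Build P T tens_poly tens_poly_zmod.
HB.instance Definition _ := GRing.isMonoidMorphism.Build P T tens_poly tens_poly_monoid.
HB.instance Definition _ := GRing.isScalable.Build K P T *:%R tens_poly tens_poly_scale.

Lemma wtensE a f : wtens a f = tens_weyl a * tens_poly f.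
Proof. by rewrite -tensM mulr1 mul1r. Qed.

Lemma tens_poly_central f u : tens_poly f * u = u * tens_poly f.
Proof.
elim/weyl_poly_gen_ind: u => [a g|c|u v Hu Hv|u v Hu Hv].
- by rewrite -!tensM mul1r mulr1 mulrC.
- by rewrite -scalerAr -scalerAl mulr1 mul1r.
- by rewrite mulrDl mulrDr Hu Hv.
- by rewrite mulrA Hu -!mulrA Hv.
Qed.

End TensorMaps.

Lemma mmap_morph (r : nat) (R R' : nzRingType) (A B : nzRingType)
    (inc : {rmorphism R -> A}) (inc' : {rmorphism R' -> B})
    (h : {rmorphism A -> B}) (ga : {rmorphism R -> R'})
    (z : 'I_r -> A) (z' : 'I_r -> B) F :
  (forall c, h (inc c) = inc' (ga c)) -> (forall i, h (z i) = z' i) ->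
  h (mmap inc z F) = mmap inc' z' (map_mpoly ga F).
Proof.
move=> hinc hz; elim/mpolyind: F => [|c l F _ _ IHF]; first by rewrite !raddf0.
rewrite mmapD rmorphD IHF raddfD /= mmapD; congr (_ + _).
rewrite mmapZ map_mpolyZ mmapZ map_mpolyX !mmapX rmorphM hinc.
congr (_ * _); rewrite rmorph_prod; apply: eq_bigr => i _.
by rewrite rmorphXn hz.
Qed.

Lemma weylz_morph n (A B : nzRingType) (h : {rmorphism A -> B}) (q p : 'I_n -> A) i :
  h (weylz q p i) = weylz (h \o q) (h \o p) i.
Proof. by rewrite /weylz; case: split. Qed.

Lemma commutator_morph (A B : nzRingType) (h : {rmorphism A -> B}) a b c :
  a * b - b * a = c -> h a * h b - h b * h a = h c.
Proof. by move=> <-; rewrite rmorphB !rmorphM. Qed.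

(** * Normal forms in A_n and in A_n (x) P_m *)

Section WeylPolynomials.
Variables (K : fieldType).
Hypothesis natU : forall k, (k.+1%:R : K) \is a GRing.unit.

Lemma mpoly_natU m k : (k.+1%:R : {mpoly K[m]}) \is a GRing.unit.
Proof. by rewrite -(rmorph_nat (@mpolyC m K)) rmorph_unit. Qed.

Section Weyl.
Variable n : nat.
Notation W := (weyl K n).
Notation zW := (weylz (@weylQ K n) (@weylP K n)).

Definition weylPhi : {mpoly K[n + n]} -> W := mmap (in_alg W) zW.

Lemma in_alg_central c (a : W) : in_alg W c * a = a * in_alg W c.
Proof. by rewrite in_algE -scalerAl -scalerAr mul1r mulr1. Qed.

Lemma in_alg_inj : injective (in_alg W).
Proof. exact: fmorph_inj. Qed.

Lemma weylPhi_inj : injective weylPhi.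
Proof.
have [pq pp qq] := weyl_relations K n.
exact: (weyl_mmap_inj natU in_alg_central pq pp qq in_alg_inj).
Qed.

Lemma weylPhi_surj a : exists f, a = weylPhi f.
Proof.
have [pq pp qq] := weyl_relations K n.
apply: stabilizes_mmap; elim/weyl_gen_ind: a => [i|c|a b|a b].
- exact: (stabilizes_z in_alg_central pq pp qq).
- exact: stabilizes_inc.
- exact: stabilizesD.
- exact: stabilizesM.
Qed.

End Weyl.

Section WeylPoly.
Variables (n m : nat).
Notation W := (weyl K n).
Notation T := (weyl_poly K n m).
Notation P := {mpoly K[m]}.
Notation tW := (@tens_weyl K n m).
Notation tP := (@tens_poly K n m).
Notation zW := (weylz (@weylQ K n) (@weylP K n)).
Notation zT := (weylz (tW \o @weylQ K n) (tW \o @weylP K n)).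

Lemma weyl_relations_morph (A : algType K) (h : {lrmorphism W -> A}) :
  let q := h \o @weylQ K n in let p := h \o @weylP K n in
  [/\ forall i j, p i * q j - q j * p i = (i == j)%:R,
      forall i j, p i * p j - p j * p i = 0 &
      forall i j, q i * q j - q j * q i = 0].
Proof.
have [pq pp qq] := weyl_relations K n.
split=> i j /=.
- by rewrite (commutator_morph h (pq i j)) rmorph_nat.
- by rewrite (commutator_morph h (pp i j)) rmorph0.
- by rewrite (commutator_morph h (qq i j)) rmorph0.
Qed.

Definition wpPhi : {mpoly P[n + n]} -> T := mmap tP zT.

Lemma wpPhi_surj u : exists F, u = wpPhi F.
Proof.
have [pq pp qq] := weyl_relations_morph tW.
apply: stabilizes_mmap; elim/weyl_poly_gen_ind: u => [a f|c|a b|a b].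
- rewrite wtensE; apply: stabilizesM; last exact: stabilizes_inc.
  elim/weyl_gen_ind: a => [i|c|a b Ha Hb|a b Ha Hb].
  + rewrite weylz_morph.
    exact: (stabilizes_z (@tens_poly_central K n m) pq pp qq).
  + rewrite linearZ /= rmorph1 -(rmorph1 tP) -linearZ.
    exact: stabilizes_inc.
  + by rewrite raddfD; apply: stabilizesD.
  + by rewrite rmorphM; apply: stabilizesM.
- rewrite -(rmorph1 tP) -linearZ; exact: stabilizes_inc.
- exact: stabilizesD.
- exact: stabilizesM.
Qed.

Lemma weyl_ev_exists (c : 'I_m -> K) : exists F : {lrmorphism T -> W},
  forall a f, F (wtens a f) = f.@[c] *: a.
Proof.
pose be : {rmorphism P -> W} := in_alg W \o meval c.
have [||F FE] := @weyl_poly_lift K n m W idfun be.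
- by move=> d f; rewrite /be /= mevalZ scalerA.
- by move=> a f; rewrite in_alg_central.
by exists F => a f; rewrite FE /= -scalerAr mulr1.
Qed.

(** Evaluation of the central variables at the point c of K^m. *)
Definition weyl_ev c : {lrmorphism T -> W} := projT1 (cid (weyl_ev_exists c)).

Lemma weyl_evE c a f : weyl_ev c (wtens a f) = f.@[c] *: a.
Proof. exact: (projT2 (cid (weyl_ev_exists c))). Qed.

Lemma weyl_ev_tW c a : weyl_ev c (tW a) = a.
Proof. by rewrite weyl_evE meval1 scale1r. Qed.

Lemma weyl_ev_tP c f : weyl_ev c (tP f) = in_alg W f.@[c].
Proof. by rewrite weyl_evE. Qed.

Lemma weyl_ev_Phi c F : weyl_ev c (wpPhi F) = weylPhi (map_mpoly (meval c) F).
Proof.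
rewrite /wpPhi /weylPhi.
apply: (@mmap_morph _ _ _ _ _ tP (in_alg W) (weyl_ev c) (meval c)) => [f|i].
  exact: weyl_ev_tP.
by rewrite -(weylz_morph tW) /= weyl_ev_tW.
Qed.

Lemma map_meval_eq0 (F : {mpoly P[n + n]}) :
  (forall c, map_mpoly (meval c) F = 0) -> F = 0.
Proof.
move=> F0; apply/mpolyP => l; rewrite mcoeff0.
apply: (mpoly_eq0_of_meval natU) => c.
by rewrite -(mcoeff_map_mpoly (meval c)) F0 mcoeff0.
Qed.

Lemma weyl_ev_eq0 u : (forall c, weyl_ev c u = 0) -> u = 0.
Proof.
have [F ->] := wpPhi_surj u => u0; rewrite (map_meval_eq0 (F := F)) ?raddf0 //.
  exact: mmap0.
move=> c; apply: weylPhi_inj; rewrite -weyl_ev_Phi u0.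
exact/esym/mmap0.
Qed.

Lemma tens_poly_inj : injective tP.
Proof.
move=> f g fg; apply/eqP; rewrite -subr_eq0; apply/eqP.
apply: (mpoly_eq0_of_meval natU) => c; apply: (@in_alg_inj n).
by rewrite -weyl_ev_tP raddfB /= fg subrr raddf0 scale0r.
Qed.

(** The h(z_i) satisfy the Weyl relations again, so the ordered monomials in them
    are linearly independent over P_m. *)
Lemma weyl_poly_mmap_inj (h : {lrmorphism W -> T}) :
  injective (mmap tP (weylz (h \o @weylQ K n) (h \o @weylP K n))).
Proof.
have [pq pp qq] := weyl_relations_morph h.
apply: (weyl_mmap_inj _ _ pq pp qq tens_poly_inj).
  exact: mpoly_natU.
exact: tens_poly_central.
Qed.

(** * JD implies JC and DP *)

(** Apply JD to id (x) tau.  A preimage of 1 (x) f is a sum of terms z^l (x) F_l,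
    and id (x) tau acts on the coefficients F_l; the constant coefficient of the
    preimage is mapped to f. *)
Lemma JD_JC : JD K n m -> JC K m.
Proof.
move=> jd tau jac.
have [||sigma sE] := @weyl_poly_lift K n m T tW (tP \o tau).
- by move=> c f; rewrite /= !linearZ.
- by move=> a f; rewrite /= tens_poly_central.
have stP f : sigma (tP f) = tP (tau f) by rewrite sE rmorph1 mul1r.
have stW a : sigma (tW a) = tW a by rewrite sE !rmorph1 mulr1.
have [sinv sK Ks] := jd sigma (fun i => tau 'X_i) (fun i => stP _) jac.
have tau_inj : injective tau.
  move=> f g fg; apply: tens_poly_inj; apply: (can_inj sK).
  by rewrite !stP fg.
have tau_surj f : exists g, tau g = f.
  have [F FE] := wpPhi_surj (sinv (tP f)).
  exists F@_0.
  have : sigma (sinv (tP f)) = tP f by rewrite Ks.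
  rewrite FE /wpPhi (@mmap_morph _ _ _ _ _ tP tP sigma tau zT zT) //; last first.
    by move=> i; rewrite -(weylz_morph tW) /= stW.
  have -> : tP f = mmap tP zT f%:MP by rewrite mmapC.
  move/weyl_poly_mmap_inj => /(congr1 (mcoeff 0%MM)).
  by rewrite mcoeff_map_mpoly mcoeffC eqxx mulr1.
have [g gE] := choice tau_surj.
by exists g => f; [apply: tau_inj|]; rewrite gE.
Qed.

(** Apply JD to s (x) id, and evaluate the central variables at 0. *)
Lemma JD_DP : JD K n m -> DP K n.
Proof.
move=> jd s.
have [||sigma sE] := @weyl_poly_lift K n m T (tW \o s) tP.
- by move=> c f; apply: tensZr.
- by move=> a f; rewrite tens_poly_central.
have stP f : sigma (tP f) = tP f by rewrite sE rmorph1 mul1r.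
have stW a : sigma (tW a) = tW (s a) by rewrite sE rmorph1 mulr1.
have jac1 : in_Kstar (jacobian (fun i : 'I_m => 'X_i : {mpoly K[m]})).
  exists 1; first exact: oner_neq0.
  rewrite /jacobian (_ : \matrix_(_, _) _ = 1%:M) ?det1 //.
  apply/matrixP => i j; rewrite !mxE mderivX mnm1E.
  have [->|_] := eqVneq i j; last by rewrite scale0r.
  suff -> : (U_(j) - U_(j) = 0 :> 'X_{1..m})%MM by rewrite scale1r mpolyX0.
  by apply/mnmP=> k; rewrite mnmBE subnn mnm0E.
have [sinv sK Ks] := jd sigma _ (fun i => stP _) jac1.
pose c0 : 'I_m -> K := fun=> 0.
have s_ev u : weyl_ev c0 (sigma u) = s (weyl_ev c0 u).
  elim/weyl_poly_gen_ind: u => [a f|d|u v Hu Hv|u v Hu Hv].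
  - by rewrite sE rmorphM /= weyl_ev_tW weyl_ev_tP weyl_evE linearZ /= -scalerAr mulr1.
  - by rewrite !linearZ /= !rmorph1.
  - by rewrite !raddfD /= Hu Hv.
  - by rewrite !rmorphM /= Hu Hv.
have s_inj : injective s.
  move=> a b ab; rewrite -(weyl_ev_tW c0 a) -(weyl_ev_tW c0 b).
  by congr (weyl_ev _ _); apply: (can_inj sK); rewrite !stW ab.
have s_surj a : s (weyl_ev c0 (sinv (tW a))) = a.
  by rewrite -s_ev Ks weyl_ev_tW.
by exists (fun a => weyl_ev c0 (sinv (tW a))) => a //; apply: s_inj.
Qed.

End WeylPoly.
End WeylPolynomials.

(** * The degree of the inverse of an automorphism of A_n *)

Section LinearDependence.
Variables (K : fieldType) (r : nat).
Implicit Types (I : finType).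

(** Polynomials of degree less than M have all exponents less than M, so they lie
    in a space of dimension at most M^r. *)
Lemma mpoly_dependent I (g : I -> {mpoly K[r]}) M :
  (forall x, (msize (g x) <= M)%N) -> (M ^ r < #|I|)%N ->
  exists2 v : I -> K, (exists x, v x != 0) & \sum_x v x *: g x = 0.
Proof.
move=> gM cardI.
pose mon (be : {ffun 'I_r -> 'I_M}) : 'X_{1..r} := [multinom (be j : nat) | j < r].
pose B := \matrix_(k < #|I|, l < #|{ffun 'I_r -> 'I_M}|)
  (g (enum_val k))@_(mon (enum_val l)).
have : kermx B != 0.
  rewrite -mxrank_eq0 mxrank_ker subn_eq0 -ltnNge.
  by apply: leq_ltn_trans (rank_leq_col _) _; rewrite card_ffun !card_ord.
case/rowV0Pn => row /sub_kermxP rowB row0.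
exists (fun x => row 0 (enum_rank x)).
  apply/existsP; apply: contraNT row0; rewrite negb_exists => /forallP v0.
  apply/eqP/rowP => k; rewrite mxE -(enum_valK k).
  by have := v0 (enum_val k); rewrite negbK => /eqP.
apply/mpolyP => mu; rewrite mcoeff0 linear_sum /=.
under eq_bigr do rewrite mcoeffZ.
have [muM|] := ltnP (mdeg mu) M; last first.
  move=> Mmu; rewrite big1 // => x _.
  by rewrite (memN_msupp_eq0 (msize_mdeg_ge (leq_trans (gM x) Mmu))) mulr0.
have muj j : (mu j < M)%N.
  by apply: leq_ltn_trans muM; rewrite mdegE (bigD1 j) //= leq_addr.
pose be := [ffun j => Ordinal (muj j)].
have beE : mon be = mu by apply/mnmP => j; rewrite mnmE ffunE.
have /rowP/(_ (enum_rank be)) := rowB; rewrite !mxE => B0.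
rewrite -[RHS]B0 (reindex (@enum_val I I)) /=; last first.
  exact/onW_bij/enum_val_bij.
by apply: eq_bigr => k _; rewrite enum_valK !mxE enum_rankK beE.
Qed.

Lemma mlead_independent I (h : I -> {mpoly K[r]}) (v : I -> K) :
  (forall x, h x != 0) -> injective (fun x => mlead (h x)) ->
  \sum_x v x *: h x = 0 -> forall x, v x = 0.
Proof.
move=> h0 hinj sum0 x0; apply/eqP/negPn/negP => vx0.
case: (@arg_maxP _ _ _ x0 (fun x => v x != 0) (fun x => mlead (h x)) vx0).
move=> x vx xmax.
have := congr1 (mcoeff (mlead (h x))) sum0.
rewrite linear_sum (bigD1 x) //= big1 => [|y yx].
  by move/eqP; rewrite addr0 mcoeff0 mcoeffZ mulf_eq0 (negPf vx) mleadc_eq0 (negPf (h0 x)).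
rewrite mcoeffZ; have [->|vy] := eqVneq (v y) 0; first by rewrite mul0r.
rewrite mcoeff_gt_mlead ?mulr0 // lt_neqAle (inj_eq hinj) yx.
exact: xmax.
Qed.

End LinearDependence.

Section DegreeBound.
Variables (K : fieldType) (n : nat).
Hypothesis natU : forall k, (k.+1%:R : K) \is a GRing.unit.
Notation W := (weyl K n).
Notation r := (n + n)%N.
Notation zW := (weylz (@weylQ K n) (@weylP K n)).
Notation Phi := (@weylPhi K n).

(** The filtration of A_n by total degree in the generators, read off from the
    normal form. *)
Definition weyl_deg_le M a := exists2 f, a = Phi f & (msize f <= M.+1)%N.
Definition weyl_lead mu a := exists h, [/\ a = Phi h, h != 0 & mlead h = mu].

Lemma weylPhi_mul f g : exists2 e,
  Phi f * Phi g = Phi (f * g + e) & (msize e <= (msize f + msize g).-2)%N.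
Proof.
have [pq pp qq] := weyl_relations K n.
exact: (mmap_mul_lead (@in_alg_central K n) pq pp qq).
Qed.

Lemma weylPhi1 : Phi 1 = 1.
Proof. by rewrite -mpolyC1 [LHS](@mmapC _ _ _ _ (in_alg W)) /= scale1r. Qed.

Lemma weylPhi_X i : Phi 'X_i = zW i.
Proof. by rewrite [LHS](@mmapX _ _ _ _ (in_alg W)) mmap1U. Qed.

Lemma weyl_deg_leM M N a b :
  weyl_deg_le M a -> weyl_deg_le N b -> weyl_deg_le (M + N) (a * b).
Proof.
move=> [f -> fM] [g -> gN]; have [e -> es] := weylPhi_mul f g.
exists (f * g + e) => //; apply: leq_trans (msizeD_le _ _) _.
rewrite geq_max; apply/andP; split; last by lia.
have fgM : (msize (f * g) <= (msize f + msize g).-1)%N := msizeM_pred f g.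
by apply: leq_trans fgM _; lia.
Qed.

Lemma weyl_deg_leX M a k : weyl_deg_le M a -> weyl_deg_le (k * M) (a ^+ k).
Proof.
move=> aM; elim: k => [|k IHk].
  by exists 1; rewrite ?weylPhi1 // msize1.
by rewrite exprS mulSn; apply: weyl_deg_leM.
Qed.

Lemma weyl_deg_le_mmap1 d (x : 'I_r -> W) mu :
  (forall i, weyl_deg_le d (x i)) -> weyl_deg_le (mdeg mu * d) (mmap1 x mu).
Proof.
move=> xd; rewrite mdegE big_distrl /=.
apply: (big_ind2 (fun N a => weyl_deg_le N a)).
- by exists 1; rewrite ?weylPhi1 // msize1.
- by move=> *; apply: weyl_deg_leM.
- by move=> i _; apply: weyl_deg_leX.
Qed.

Lemma weyl_deg_le_trans M N a : (M <= N)%N -> weyl_deg_le M a -> weyl_deg_le N a.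
Proof. by move=> MN [f -> fM]; exists f => //; apply: leq_trans fM _. Qed.

Lemma weyl_leadM mu nu a b :
  weyl_lead mu a -> weyl_lead nu b -> weyl_lead (mu + nu)%MM (a * b).
Proof.
move=> [f [-> f0 <-]] [g [-> g0 <-]]; have [e -> es] := weylPhi_mul f g.
have fg0 : f * g != 0 by rewrite mulf_neq0.
have {es} efg : (msize e < msize (f * g))%N.
  have fgs : msize (f * g) = (msize f + msize g).-1 := msizeM f0 g0.
  rewrite [X in (_ < X)%N]fgs; apply: leq_ltn_trans es _.
  move: f0 g0; rewrite -!(mmeasure_poly_eq0 mdeg) -!lt0n.
  by case: (msize f) => // k _; case: (msize g) => // l _; rewrite addSn addnS.
exists (f * g + e); split=> //.
  apply: contraTneq efg => /eqP; rewrite addr_eq0 => /eqP->.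
  by rewrite mmeasureN ltnn.
rewrite -mleadM //; have [->|e0] := eqVneq e 0; first by rewrite addr0.
apply: mleadDl; apply: lt_mdeg_ltmc.
by rewrite -ltnS !mlead_deg.
Qed.

Lemma weyl_leadX mu a k : weyl_lead mu a -> weyl_lead (mu *+ k)%MM (a ^+ k).
Proof.
move=> amu; elim: k => [|k IHk].
  by exists 1; rewrite weylPhi1 oner_neq0 mlead1 mulm0n.
by rewrite exprS mulmS; apply: weyl_leadM.
Qed.

Lemma weyl_lead_mmap1 mu : weyl_lead mu (mmap1 zW mu).
Proof.
exists 'X_[mu]; split; last exact: mleadXm.
  by rewrite [RHS](@mmapX _ _ _ _ (in_alg W)).
by rewrite -(mmeasure_poly_eq0 mdeg) msizeX.
Qed.

Lemma weylPhiZ c f : Phi (c *: f) = c *: Phi f.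
Proof. by rewrite [LHS](@mmapZ _ _ _ _ (in_alg W)) /= -scalerAl mul1r. Qed.

Lemma weylPhi_sum I (s : seq I) (F : I -> {mpoly K[r]}) :
  Phi (\sum_(x <- s) F x) = \sum_(x <- s) Phi (F x).
Proof. exact: (raddf_sum (mmap (in_alg W) zW)). Qed.

(** With k the i-th exponent of the leading monomial of G, the elements
    (Phi G)^j z^alpha with j < k and all exponents of alpha less than k have
    distinct leading monomials: the i-th exponent determines j and the i-th
    exponent of alpha by division by k.  These are k^(r + 1) independent elements
    whose images under s have degree at most k (e + r d). *)
Lemma inverse_degree_bound (s : {lrmorphism W -> W}) d e G :
  injective s -> (forall i, weyl_deg_le d (s (zW i))) ->
  weyl_deg_le e (s (Phi G)) ->
  (forall i, mlead G i <= (e + r * d + 1) ^ r)%N.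
Proof.
move=> s_inj sd se i.
have [->|G0] := eqVneq G 0; first by rewrite mlead0 mnm0E.
rewrite leqNgt; apply/negP; set k := mlead G i => kbig.
have k0 : (0 < k)%N by apply: leq_ltn_trans kbig.
(* For x = (u, beta), beta i is the power of Phi G, and the exponent alpha is beta
   with its i-th entry replaced by u. *)
pose I : finType := ('I_k * {ffun 'I_r -> 'I_k})%type.
pose al (x : I) : 'X_{1..r} :=
  [multinom (if j == i then nat_of_ord x.1 else nat_of_ord (x.2 j)) | j < r].
pose b (x : I) := Phi G ^+ x.2 i * mmap1 zW (al x).
have b_lead (x : I) : weyl_lead (mlead G *+ x.2 i + al x)%MM (b x).
  by apply: weyl_leadM (weyl_lead_mmap1 _); apply: weyl_leadX; exists G.
have b_deg (x : I) : weyl_deg_le (k * (e + r * d)) (s (b x)).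
  rewrite /b rmorphM rmorphXn /= /mmap1 rmorph_prod /=.
  under eq_bigr do rewrite rmorphXn.
  apply: weyl_deg_le_trans (weyl_deg_leM (weyl_deg_leX _ se) (weyl_deg_le_mmap1 _ sd)).
  rewrite mulnDr; apply: leq_add; first by rewrite leq_mul2r ltnW ?orbT.
  rewrite mulnA leq_mul2r mdegE; apply/orP; right.
  apply: leq_trans (_ : \sum_(j < r) k <= _)%N; last by rewrite sum_nat_const card_ord mulnC.
  by apply: leq_sum => j _; rewrite mnmE; case: ifP => _; apply: ltnW.
have [h hP] := choice b_lead.
have /choice[g gP] : forall x : I, exists g : {mpoly K[r]},
    s (b x) = Phi g /\ (msize g <= (k * (e + r * d)).+1)%N.
  move=> x; have [f fE fs] := b_deg x; by exists f.
have [||v [x vx] vg] := @mpoly_dependent K r I g (k * (e + r * d)).+1.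
- by move=> x; case: (gP x).
- rewrite card_prod card_ffun !card_ord.
  apply: leq_ltn_trans (_ : (k * (e + r * d + 1)) ^ r < _)%N.
    have expM l1 l2 l : (l1 <= l2 -> l1 ^ l <= l2 ^ l)%N.
      by case: l => // l; rewrite leq_exp2r.
    by apply: expM; rewrite [in leqRHS]mulnDr muln1 -addn1 leq_add2l.
  by rewrite expnMn mulnC ltn_mul2r expn_gt0 k0.
have vh : \sum_x v x *: h x = 0.
  apply: (weylPhi_inj natU); apply: s_inj.
  transitivity (Phi (\sum_x v x *: g x)); last first.
    have Phi0 : Phi 0 = 0 by apply: (raddf0 (mmap (in_alg W) zW)).
    by rewrite vg Phi0 raddf0.
  rewrite !weylPhi_sum raddf_sum; apply: eq_bigr => y _ /=.
  by rewrite !weylPhiZ linearZ /= -(gP y).1; case: (hP y) => <-.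
move/eqP: vx; apply; apply: (mlead_independent _ _ vh) => [y|y y'].
  by case: (hP y).
case: (hP y) (hP y') => _ _ -> [_ _ ->] /mnmP eq_al.
have [equ eqb] : y.1 = y'.1 /\ y.2 i = y'.2 i.
  have := eq_al i; rewrite !mnmDE !mulmnE !mnmE eqxx -/k => E.
  have E1 : (y.2 i : nat) = y'.2 i.
    have := congr1 (divn^~ k) E.
    by rewrite /= ![(k * _)%N]mulnC !divnMDl // !divn_small ?addn0.
  by split; apply: val_inj => //=; move: E; rewrite E1 => /addnI.
rewrite [y]surjective_pairing [y']surjective_pairing equ; congr (_, _).
apply/ffunP => j; have [->//|ji] := eqVneq j i.
have := eq_al j; rewrite !mnmDE !mulmnE !mnmE (negPf ji) eqb => /addnI.
exact: val_inj.
Qed.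

End DegreeBound.

(** * JC and DP imply JD *)

Lemma weylD_morph n (A B : nzRingType) (h : {rmorphism A -> B}) (q p : 'I_n -> A) i a :
  h (weylD q p i a) = weylD (h \o q) (h \o p) i (h a).
Proof.
rewrite /weylD rmorphB !rmorphM; suff -> : h (weylw q p i) = weylw (h \o q) (h \o p) i by [].
by rewrite /weylw; case: split => j //=; rewrite rmorphN.
Qed.

Lemma mpoly_rmorphism_eq (K : fieldType) m (A : algType K)
    (g h : {lrmorphism {mpoly K[m]} -> A}) :
  (forall i, g 'X_i = h 'X_i) -> g =1 h.
Proof.
move=> gh; elim/mpolyind => [|c l f _ _ IHf]; first by rewrite !raddf0.
rewrite !raddfD /= IHf !linearZ /= mpolyXE_id !rmorph_prod /=.
by congr (_ *: _ + _); apply: eq_bigr => i _; rewrite !rmorphXn /= gh.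
Qed.

Section Main.
Variables (K : fieldType) (n m : nat).
Hypothesis natU : forall k, (k.+1%:R : K) \is a GRing.unit.
Notation W := (weyl K n).
Notation P := {mpoly K[m]}.
Notation T := (weyl_poly K n m).
Notation r := (n + n)%N.
Notation Phi := (@weylPhi K n).
Notation tW := (@tens_weyl K n m).
Notation tP := (@tens_poly K n m).
Notation Q := (@weylQ K n).
Notation Pw := (@weylP K n).
Notation zW := (weylz Q Pw).
Notation ev := (@weyl_ev K n m).

Lemma weylD_Phi i f : weylD Q Pw i (Phi f) = Phi f^`M(i).
Proof.
have [pq pp qq] := weyl_relations K n.
exact: (weylD_mmap (@in_alg_central K n) pq pp qq).
Qed.

Lemma weylD_Phi_word w f : (msize f <= size w)%N ->
  foldr (weylD Q Pw) (Phi f) w = 0.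
Proof.
have Phi0 : Phi 0 = 0 by apply: (raddf0 (mmap (in_alg W) zW)).
have -> : foldr (weylD Q Pw) (Phi f) w = Phi (foldr (@mderiv r K) f w).
  by elim: w => //= i w ->; rewrite weylD_Phi.
move=> fw; suff fn0 : (msize (foldr (@mderiv r K) f w) <= msize f - size w)%N.
  by move: fn0; rewrite (eqP fw) leqn0 mmeasure_poly_eq0 => /eqP->.
elim: {fw} w => [|j w IHw] /=; first by rewrite subn0.
by apply: leq_trans (msize_mderiv _ _) _; rewrite subnS -!subn1 leq_sub2r.
Qed.

(** In the rest of this section h is an embedding of A_n into A_n (x) P_m that
    becomes an automorphism of A_n at each point of K^m; it will be the
    restriction to A_n of the endomorphism in JD. *)
Variable h : {lrmorphism W -> T}.
Notation hQ := (h \o Q).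
Notation hP := (h \o Pw).
Notation y := (weylz hQ hP).
Hypothesis h_spec : forall c, bijective (ev c \o h).

Let evhD c i a : (ev c \o h) (weylD Q Pw i a) =
  weylD (ev c \o hQ) (ev c \o hP) i ((ev c \o h) a).
Proof. exact: (weylD_morph (ev c \o h)). Qed.

(** The degrees of the s_c(z_j) are bounded uniformly in c by those of the h(z_j), so
    the degree of s_c^-1(z_i) is bounded uniformly too, and long words in the
    derivations kill z_i at each point c. *)
Lemma generator_nilpotent i : exists k, forall w : k.-tuple 'I_r,
  foldr (weylD hQ hP) (tW (zW i)) w = 0.
Proof.
have /choice[F FE] : forall j, exists F, h (zW j) = wpPhi F.
  by move=> j; apply: wpPhi_surj.
pose d := \max_(j < r) msize (F j).
have degz c j : weyl_deg_le d ((ev c \o h) (zW j)).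
  exists (map_mpoly (meval c) (F j)).
    by rewrite /= FE weyl_ev_Phi.
  apply/msize_leP => l; rewrite mcoeff_map_mpoly => fl.
  have : l \in msupp (F j).
    by rewrite mcoeff_msupp; apply: contraNneq fl => ->; rewrite raddf0.
  move/msize_mdeg_lt => /leq_trans; apply; apply: leqW.
  exact: (leq_bigmax (F := fun j => msize (F j))).
exists (r * (1 + r * d + 1) ^ r).+1 => w.
apply: weyl_ev_eq0 => // c.
have evw a v : ev c (foldr (weylD hQ hP) a v) =
    foldr (weylD (ev c \o hQ) (ev c \o hP)) (ev c a) v.
  by elim: v => //= j v <-; rewrite weylD_morph.
rewrite evw weyl_ev_tW.
have [sinv sK Ks] := h_spec c.
have [G GE] := weylPhi_surj (sinv (zW i)).
have zE : zW i = (ev c \o h) (Phi G) by rewrite -GE Ks.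
have Gs : (msize G <= size w)%N.
  have [->|G0] := eqVneq G 0; first by rewrite mmeasure0.
  rewrite -mlead_deg // size_tuple ltnS mdegE.
  apply: leq_trans (_ : \sum_(j < r) (1 + r * d + 1) ^ r <= _)%N; last first.
    by rewrite sum_nat_const card_ord.
  apply: leq_sum => j _.
  apply: (@inverse_degree_bound _ _ natU ((ev c \o h) : {lrmorphism W -> W})).
  - exact: can_inj sK.
  - exact: degz.
  - have zi1 : weyl_deg_le 1 (zW i).
      by exists 'X_i; rewrite ?weylPhi_X // msizeX mdeg1.
    by rewrite zE in zi1.
have sw a v : foldr (weylD (ev c \o hQ) (ev c \o hP)) ((ev c \o h) a) v =
    (ev c \o h) (foldr (weylD Q Pw) a v).
  by elim: v => //= j v ->; rewrite -evhD.
by rewrite zE sw weylD_Phi_word // raddf0.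
Qed.

(** At each point c the common kernel is the image under s_c of the constants. *)
Lemma centralizer_poly u : (forall i, weylD hQ hP i u = 0) -> exists f, u = tP f.
Proof.
have [F ->] := wpPhi_surj u => uC; exists F@_0.
suff FE : F = (F@_0)%:MP by rewrite [in LHS]FE [LHS](@mmapC _ _ _ _ tP).
apply/eqP; rewrite -subr_eq0; apply/eqP; apply: map_meval_eq0 => // c.
have [sinv sK Ks] := h_spec c.
have [G GE] := weylPhi_surj (sinv (ev c (wpPhi F))).
have evE : ev c (wpPhi F) = (ev c \o h) (Phi G) by rewrite -GE Ks.
have dG i : G^`M(i) = 0.
  apply: (weylPhi_inj natU); apply: (can_inj sK).
  rewrite -weylD_Phi evhD -evE.
  have := congr1 (ev c) (uC i); rewrite weylD_morph => ->.
  have Phi0 : Phi 0 = 0 by apply: (raddf0 (mmap (in_alg W) zW)).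
  by rewrite Phi0 /= !raddf0.
have PhiC k : Phi k%:MP = k%:A by apply: (mmapC zW (in_alg W)).
move: evE; rewrite (mderiv_eq0 natU dG) PhiC /= !linearZ /= !rmorph1 -PhiC.
rewrite weyl_ev_Phi => /(weylPhi_inj natU) FcE.
rewrite raddfB /= FcE; apply/eqP; rewrite subr_eq0 map_mpolyC.
by rewrite -(mcoeff_map_mpoly (meval c)) FcE mcoeffC eqxx mulr1.
Qed.

Lemma generator_in_span i : exists F, tW (zW i) = mmap tP y F.
Proof.
have [pq pp qq] := weyl_relations_morph h.
have [k kP] := generator_nilpotent i.
apply: (mmap_surj_nilpotent (D := weylD hQ hP)) kP.
- exact: (weylD_mmap (@tens_poly_central K n m) pq pp qq).
- exact: weylD_add.
- exact: mpoly_natU.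
- exact: tens_poly_inj.
- exact: (weylD_comm (@tens_poly_central K n m) pq pp qq).
- exact: centralizer_poly.
Qed.

End Main.

Lemma JC_DP_JD (K : fieldType) (n m : nat) :
  (forall k, (k.+1%:R : K) \is a GRing.unit) -> JC K m -> DP K n -> JD K n m.
Proof.
move=> natU jc dp sigma f sf jac.
pose tP := @tens_poly K n m; pose tW := @tens_weyl K n m.
pose tau : {lrmorphism {mpoly K[m]} -> {mpoly K[m]}} := comp_mpoly [tuple f i | i < m].
have tauX i : tau 'X_i = f i by rewrite /tau /= comp_mpolyXU -tnth_nth tnth_mktuple.
have [tinv tK Kt] : bijective tau.
  by apply: jc; rewrite (_ : (fun i => tau 'X_i) = f) //; apply/funext.
have stP : sigma \o tP =1 tP \o tau.
  by apply: mpoly_rmorphism_eq => i /=; rewrite [sigma _]sf tauX.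
pose h : {lrmorphism weyl K n -> weyl_poly K n m} := sigma \o tW.
have h_spec c : bijective (@weyl_ev K n m c \o h) by apply: dp.
pose zT := weylz (tW \o @weylQ K n) (tW \o @weylP K n).
pose y := weylz (h \o @weylQ K n) (h \o @weylP K n).
have sz i : sigma (zT i) = y i by rewrite weylz_morph.
have sigma_inj : injective sigma.
  suff ker u : sigma u = 0 -> u = 0.
    move=> u v uv; apply/eqP; rewrite -subr_eq0; apply/eqP/ker.
    by rewrite raddfB /= uv subrr.
  have [F ->] := wpPhi_surj u.
  rewrite [sigma _](@mmap_morph _ _ _ _ _ tP tP sigma tau zT y) //.
  rewrite -{1}(raddf0 (mmap tP y)) => /(weyl_poly_mmap_inj natU) => tF0.
  suff -> : F = 0 by apply: (raddf0 (mmap tP zT)).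
  apply/mpolyP => l; apply: (can_inj tK).
  by rewrite -(mcoeff_map_mpoly tau) tF0 !mcoeff0 raddf0.
(* The coefficients of a polynomial in the y's lie in P_m, which is the image of
   tau, so the polynomial itself lies in the image of sigma. *)
have surj_gen i : exists v, sigma v = tW (weylz (@weylQ K n) (@weylP K n) i).
  have [F FE] := generator_in_span natU h_spec i.
  exists (\sum_(l <- msupp F) tP (tinv F@_l) * mmap1 zT l).
  rewrite [RHS]FE rmorph_sum; apply: eq_bigr => l _; rewrite rmorphM /=.
  rewrite (stP _ : sigma (tP _) = _) /= Kt; congr (_ * _).
  rewrite /mmap1 rmorph_prod; apply: eq_bigr => j _.
  by rewrite rmorphXn /= sz.
have surjD a b : (exists v, sigma v = a) -> (exists v, sigma v = b) -> exists v, sigma v = a + b.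
  by move=> [u <-] [v <-]; exists (u + v); rewrite raddfD.
have surjM a b : (exists v, sigma v = a) -> (exists v, sigma v = b) -> exists v, sigma v = a * b.
  by move=> [u <-] [v <-]; exists (u * v); rewrite rmorphM.
have surj1 (c : K) : exists v, sigma v = c%:A.
  by exists c%:A; rewrite linearZ /= rmorph1.
have /choice[g gE] : forall u, exists v, sigma v = u.
  apply: weyl_poly_gen_ind => [a k|c|a b|a b] //; try by [apply: surjD | apply: surjM].
  rewrite wtensE; apply: (surjM _ _); last first.
    by exists (tP (tinv k)); rewrite [sigma _]stP /= Kt.
  elim/weyl_gen_ind: a => [//|c|a b Ha Hb|a b Ha Hb].
  - by rewrite linearZ /= rmorph1.
  - by rewrite raddfD; apply: surjD.
  - by rewrite rmorphM; apply: surjM.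
by exists g => u; [apply: sigma_inj|]; rewrite gE.
Qed.

Theorem corollary2p5 (K : fieldType) (charK0 : [pchar K] =i pred0) :
  ((forall n m : nat, JD K n m) <->
     (forall m : nat, JC K m) /\ (forall n : nat, DP K n)) /\
  (forall n : nat, JD K n n <-> JC K n /\ DP K n).
Proof.
have natU k : (k.+1%:R : K) \is a GRing.unit.
  by rewrite unitfE ((pcharf0P K).1 charK0).
have jdP n m : JD K n m <-> JC K m /\ DP K n.
  split=> [jd|[jc dp]]; last exact: JC_DP_JD.
  by split; [apply: (JD_JC natU jd)|apply: (JD_DP jd)].
split=> [|n]; last exact: jdP.
split=> [jd|[jc dp] n m]; last exact/jdP.
by split=> k; have /jdP[] := jd k k.
Qed.
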